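(* Fix $s^*>0$ (a fixed constant of the problem), and let $\sigma_0>0$, $\mu,r\in\mathbb{R}$, $0<\tau_1<\tau_2$, $b>0$ and $\omega=(-b,b)$. Suppose that $$\frac{\tau_1^2+\tau_2^2+\sqrt{\tau_1\tau_2}(\tau_1+\tau_2)}{\tau_1\tau_2(\tau_2-\tau_1)}\,\frac{3b^2}{2\sigma_0^2}<1$$ and $$\frac{\left(\sqrt{\frac{\tau_1}{\tau_2}}+\sqrt{\frac{\tau_2}{\tau_1}}+2\right)\frac{b^2}{\sigma_0^2}+2\sqrt{2\pi}\,(\sqrt{\tau_1}+\sqrt{\tau_2})\frac{b}{\sigma_0}}{2(\tau_2-\tau_1)}<1.$$ Then, for given data $V_1,V_2$ on $\omega$, there is at most one pair $(f_0,f_1)\in L^\infty(\omega)\times L^\infty(\omega)$, extended by $f_0=f_1=0$ outside $\omega$, solving the linearized inverse option pricing problem, i.e. such that the solution $V(y,\tau)$ of $$\frac{\partial V}{\partial\tau}-\frac12\sigma_0^2\frac{\partial^2V}{\partial y^2}+\Bigl(\frac{\sigma_0^2}{2}+\mu\Bigr)\frac{\partial V}{\partial y}+(r-\mu)V=\alpha_0(y,\tau)\bigl(f_0(y)+\tau f_1(y)\bigr),\quad y\in\mathbb{R},\ 0<\tau<\tau_2,\qquad V(y,0)=0,\quad y\in\mathbb{R},$$ satisfies $V(y,\tau_j)=V_j(y)$ for $y\in\omega$, $j=1,2$. Moreover, there is a constant $C$ depending only on $\sigma_0,\tau_1,\tau_2,b$ (with $s^*$ fixed) such that any solution $(f_0,f_1)$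 of this inverse problem satisfies $$\|f_0\|_\infty(\omega)+\|f_1\|_\infty(\omega)\le C\bigl(\|W_1''\|_\infty(\omega)+\|W_2''\|_\infty(\omega)\bigr),$$ where $W_j(y)=e^{-cy-d\tau_j}V_j(y)$, $y\in\omega$, $j=1,2$.
   Context: Here $$\alpha_0(y,\tau)=\frac{s^*}{\sqrt{2\pi\tau}\,\sigma_0}e^{-\frac{y^2}{2\tau\sigma_0^2}+cy+d\tau},\qquad c=\frac12+\frac{\mu}{\sigma_0^2},\qquad d=-\frac{1}{2\sigma_0^2}\Bigl(\frac{\sigma_0^2}{2}+\mu\Bigr)^2+\mu-r.$$ $\|f\|_\infty(\omega)$ is the essential supremum of $|f|$ over $\omega$; derivatives $W_j''$ are with respect to $y$ (in the weak sense). The solution $V$ of the Cauchy problem is the usual one given by the fundamental solution of the constant coefficient parabolic equation; equivalently, $V=e^{cy+d\tau}W$ where $W$ is the bounded solution, given by convolution with the Gaussian heat kernel, of $\partial_\tau W-\frac12\sigma_0^2\partial_y^2W=\frac{s^*}{\sqrt{2\pi\tau}\sigma_0}e^{-\frac{y^2}{2\tau\sigma_0^2}}(f_0(y)+\tau f_1(y))$ for $y\in\mathbb{R}$, $0<\tau<\tau_2$, with $W(y,0)=0$. *)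

(* Defs.v *)
From HB Require Import structures.
From mathcomp Require Import all_boot all_order all_algebra.
From mathcomp Require Import all_classical all_reals all_analysis.
From mathcomp Require Import ess_sup_inf.
From mathcomp Require Import ring lra.

Set Implicit Arguments.
Unset Strict Implicit.
Unset Printing Implicit Defensive.

Import Order.TTheory GRing.Theory Num.Theory.
Import numFieldNormedType.Exports.

Local Open Scope classical_set_scope.
Local Open Scope ring_scope.

Section Cauchy_problem.
Context {R : realType}.
Implicit Types (s sigma mu r y z t tau theta : R).

Definition coef_c sigma mu : R := 1 / 2 + mu / sigma ^+ 2.

Definition coef_d sigma mu r : R :=
  - (1 / (2 * sigma ^+ 2)) * (sigma ^+ 2 / 2 + mu) ^+ 2 + mu - r.

Definition gauss_kernel sigma t y : R :=
  (Num.sqrt (2 * pi * t) * sigma)^-1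
    * expR (- (y ^+ 2 / (2 * t * sigma ^+ 2))).

Definition alpha0 s sigma mu r y tau : R :=
  s / (Num.sqrt (2 * pi * tau) * sigma)
    * expR (- (y ^+ 2 / (2 * tau * sigma ^+ 2))
            + coef_c sigma mu * y + coef_d sigma mu r * tau).

(* Fundamental solution, with pole at (0, 0), of the operator
   d/dtau - sigma^2/2 d^2/dy^2 + (sigma^2/2 + mu) d/dy + (r - mu):
   a Gaussian transported with speed sigma^2/2 + mu and damped at rate r - mu.
   It is only used for t > 0. *)
Definition fundsol sigma mu r t y : R :=
  gauss_kernel sigma t (y - (sigma ^+ 2 / 2 + mu) * t) * expR (- ((r - mu) * t)).

(* The solution V(y, tau) given by the fundamental solution, with zero initial
   value and right-hand side alpha0(z, theta) (f0(z) + theta f1(z)). *)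
Definition cauchy_solution s sigma mu r (f0 f1 : R -> R) y tau : R :=
  \int[lebesgue_measure]_(theta in `]0, tau[)
    \int[lebesgue_measure]_z
      (fundsol sigma mu r (tau - theta) (y - z)
         * (alpha0 s sigma mu r z theta * (f0 z + theta * f1 z))).

(* [is_derive] kept away from type class resolution. *)
Let is_d (x : R) (f : R -> R) (a : R) := is_derive x 1 f a.

Let dE (f : R -> R) (x b : R) : (exists2 a, is_d x f a & a = b) -> is_d x f b.
Proof. by case=> a + <-. Qed.

Let dC (k x : R) : is_d x (fun _ : R => k) 0.
Proof. exact: is_derive_cst. Qed.

Let dI (x : R) : is_d x (fun u : R => u) 1.
Proof. exact: is_derive_id. Qed.

Let dD (f g : R -> R) (x a b : R) : is_d x f a -> is_d x g b ->
  is_d x (fun u => f u + g u) (a + b).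
Proof. by rewrite /is_d => *; exact: is_deriveD. Qed.

Let dN (f : R -> R) (x a : R) : is_d x f a ->
  is_d x (fun u => - f u) (- a).
Proof. by rewrite /is_d => *; exact: is_deriveN. Qed.

Let dM (f g : R -> R) (x a b : R) : is_d x f a -> is_d x g b ->
  is_d x (fun u => f u * g u) (f x * b + g x * a).
Proof. by rewrite /is_d => *; exact: is_deriveM. Qed.

Let dX (f : R -> R) (x a : R) : is_d x f a ->
  is_d x (fun u => f u ^+ 2) (2 * f x * a).
Proof.
by move=> fa; apply: dE; eexists; [exact: (dM fa fa)|ring].
Qed.

Let dV (f : R -> R) (x a : R) : f x != 0 -> is_d x f a ->
  is_d x (fun u => (f u)^-1) (- (f x) ^- 2 * a).
Proof. by rewrite /is_d => ? ?; exact: is_deriveV. Qed.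

Let dexp (f : R -> R) (x a : R) : is_d x f a ->
  is_d x (fun u => expR (f u)) (expR (f x) * a).
Proof. by rewrite /is_d => ?; exact: is_derive1_comp. Qed.

Let dsqrt (f : R -> R) (x a : R) : 0 < f x -> is_d x f a ->
  is_d x (fun u => Num.sqrt (f u)) ((2 * Num.sqrt (f x))^-1 * a).
Proof.
by rewrite /is_d => f0 ?; have ? := is_derive1_sqrt f0; exact: is_derive1_comp.
Qed.

Let fundsol_dy sigma mu r t y : 0 < sigma -> 0 < t ->
  is_d y (fundsol sigma mu r t)
    (- ((y - (sigma ^+ 2 / 2 + mu) * t) / (t * sigma ^+ 2))
     * fundsol sigma mu r t y).
Proof.
move=> s0 t0; rewrite /fundsol /gauss_kernel.
set a := (sigma ^+ 2 / 2 + mu); set k := _^-1.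
apply: dE; eexists.
  apply: dM; last exact: dC.
  apply: dM; first exact: dC.
  apply: dexp.
  apply: dN; apply: dM; last exact: dC.
  by apply: dX; apply: dD; [exact: dI|exact: dC].
rewrite /=; field.
by rewrite !gt_eqF.
Qed.

Let fundsol_dt sigma mu r t y : 0 < sigma -> 0 < t ->
  is_d t (fun u => fundsol sigma mu r u y)
    ((- (2 * t)^-1
      + (sigma ^+ 2 / 2 + mu) * (y - (sigma ^+ 2 / 2 + mu) * t) / (t * sigma ^+ 2)
      + (y - (sigma ^+ 2 / 2 + mu) * t) ^+ 2 / (2 * t ^+ 2 * sigma ^+ 2)
      - (r - mu)) * fundsol sigma mu r t y).
Proof.
move=> s0 t0; rewrite /fundsol /gauss_kernel.
have p0 : 0 < 2 * pi * t :> R by rewrite !mulr_gt0 ?pi_gt0.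
have q0 : Num.sqrt (2 * pi * t) != 0 by rewrite gt_eqF ?sqrtr_gt0.
set a := (sigma ^+ 2 / 2 + mu).
apply: dE; eexists.
  apply: dM.
    apply: dM.
      apply: dV; first by apply: mulf_neq0 => //; rewrite gt_eqF.
      apply: dM; last exact: dC.
      apply: dsqrt; first exact: p0.
      by apply: dM; [exact: dC|exact: dI].
    apply: dexp.
    apply: dN; apply: dM.
      apply: dX; apply: dD; first exact: dC.
      by apply: dN; apply: dM; [exact: dC|exact: dI].
    apply: dV; first by rewrite gt_eqF// !mulr_gt0// exprn_gt0.
    apply: dM; last exact: dC.
    by apply: dM; [exact: dC|exact: dI].
  apply: dexp.
  by apply: dN; apply: dM; [exact: dC|exact: dI].
rewrite /=.
set q := Num.sqrt _ in q0 *; have qE : q ^+ 2 = 2 * pi * t by rewrite sqr_sqrtr ?ltW.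
have -> : pi = q ^+ 2 / (2 * t) :> R by rewrite qE; field; rewrite gt_eqF.
field.
by rewrite q0 !gt_eqF.
Qed.

Lemma fundsol_pde sigma mu r t y : 0 < sigma -> 0 < t ->
  let G := fundsol sigma mu r in
  [/\ derivable (fun u => G u y) t 1, derivable (G t) y 1,
      derivable (derive1 (G t)) y 1 &
      derive1 (fun u => G u y) t - 1 / 2 * sigma ^+ 2 * derive1n 2 (G t) y
        + (sigma ^+ 2 / 2 + mu) * derive1 (G t) y + (r - mu) * G t y = 0].
Proof.
move=> s0 t0 G.
have Gt := fundsol_dt mu r y s0 t0; have Gy x := fundsol_dy mu r x s0 t0.
rewrite -/G in Gt Gy.
have E : derive1 (G t) = (fun x =>
    - ((x - (sigma ^+ 2 / 2 + mu) * t) / (t * sigma ^+ 2)) * G t x).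
  apply/funext => x; rewrite derive1E.
  by rewrite (@derive_val _ _ _ _ _ _ _ (Gy x)).
have Gyy : is_derive y 1 (derive1 (G t))
    (((y - (sigma ^+ 2 / 2 + mu) * t) ^+ 2 / (t * sigma ^+ 2) ^+ 2
      - (t * sigma ^+ 2)^-1) * G t y).
  rewrite E; apply: dE; eexists.
    apply: dM; last exact: Gy.
    apply: dN; apply: dM; last exact: dC.
    by apply: dD; [exact: dI|exact: dC].
  by rewrite /= -/G; field; rewrite !gt_eqF.
split; first exact: (@ex_derive _ _ _ _ _ _ _ Gt).
- exact: (@ex_derive _ _ _ _ _ _ _ (Gy y)).
- exact: (@ex_derive _ _ _ _ _ _ _ Gyy).
rewrite derive1nS derive1n1 derive1E (@derive_val _ _ _ _ _ _ _ Gt).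
rewrite [derive1 (derive1 _) _]derive1E (@derive_val _ _ _ _ _ _ _ Gyy) E -/G.
by field; rewrite !gt_eqF.
Qed.

(* By this identity, cauchy_solution is e^(c y + d tau) W(y, tau) with W the
   heat potential of the source s / (sqrt(2 pi theta) sigma)
   e^(- z^2 / (2 theta sigma^2)) (f0(z) + theta f1(z)). *)
Lemma fundsol_alpha0 s sigma mu r y z tau theta :
  0 < sigma -> 0 < theta -> theta < tau ->
  fundsol sigma mu r (tau - theta) (y - z) * alpha0 s sigma mu r z theta
  = expR (coef_c sigma mu * y + coef_d sigma mu r * tau)
    * (gauss_kernel sigma (tau - theta) (y - z)
       * (s / (Num.sqrt (2 * pi * theta) * sigma)
          * expR (- (z ^+ 2 / (2 * theta * sigma ^+ 2))))).
Proof.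
move=> s0 th0 tht; rewrite /fundsol /alpha0 /gauss_kernel.
set A := _^-1; set B := s / _.
have eL a1 a2 a3 : A * expR a1 * expR a2 * (B * expR a3)
    = A * B * expR (a1 + a2 + a3) by rewrite !expRD; ring.
have eR a1 a2 a3 : expR a1 * (A * expR a2 * (B * expR a3))
    = A * B * expR (a1 + a2 + a3) by rewrite !expRD; ring.
rewrite eL eR; congr (_ * expR _); rewrite /coef_c /coef_d.
field.
by rewrite subr_eq0 !gt_eqF.
Qed.

End Cauchy_problem.

Section Linfty.
Context {R : realType}.

Definition omega (b : R) : set R := `]- b, b[.

Definition leb_on (b : R) : {measure set (measurableTypeR R) -> \bar R} :=
  mrestr (@lebesgue_measure R) (measurable_itv `]- b, b[).

(* Essential supremum of |f| over omega. *)
Definition normoo (b : R) (f : R -> R) : \bar R :=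
  ess_sup (leb_on b) (fun x => `|f x|%:E).

(* A class in L^oo(omega), extended by 0, is given by a Borel representative
   that vanishes identically outside omega. *)
Definition Linfty0 (b : R) (f : R -> R) : Prop :=
  f \in Lfun (leb_on b) +oo%E /\ (forall x, ~ omega b x -> f x = 0).

Definition test_function (b : R) (phi : R -> R) : Prop :=
  (forall n x, derivable (derive1n n phi) x 1) /\
  exists2 K : set R, compact K /\ K `<=` omega b &
    forall x, ~ K x -> phi x = 0.

(* g is the second distributional derivative of W on omega; it is unique up to
   equality almost everywhere on omega. *)
Definition is_weak_derivative2 (b : R) (W g : R -> R) : Prop :=
  [/\ locally_integrable (omega b) W, locally_integrable (omega b) g &
      forall phi, test_function b phi ->
        \int[lebesgue_measure]_(x in omega b) (W x * derive1n 2 phi x)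
        = \int[lebesgue_measure]_(x in omega b) (g x * phi x)].

End Linfty.

Section Inverse_problem.
Context {R : realType}.
Implicit Types (s sigma mu r b : R).

Definition inverse_solution s sigma mu r (tau1 tau2 : R) b
    (V1 V2 f0 f1 : R -> R) : Prop :=
  [/\ Linfty0 b f0, Linfty0 b f1,
      forall y, omega b y -> cauchy_solution s sigma mu r f0 f1 y tau1 = V1 y &
      forall y, omega b y -> cauchy_solution s sigma mu r f0 f1 y tau2 = V2 y].

End Inverse_problem.

(* Main.v *)
Require Import Defs.
From mathcomp Require Import all_boot all_order all_algebra.
From mathcomp Require Import all_classical all_reals all_analysis.
From mathcomp Require Import ess_sup_inf measurable_realfun.
From mathcomp Require Import ring lra.

Set Implicit Arguments.
Unset Strict Implicit.
Unset Printing Implicit Defensive.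

Import Order.TTheory GRing.Theory Num.Theory.
Import numFieldNormedType.Exports.

Local Open Scope classical_set_scope.
Local Open Scope ring_scope.

(** Why the theorem is true.

    Write [K t] for the centred Gaussian density of variance [sigma ^+ 2 * t]
    and [E] for its tail at time [tau]. After division by the exponential
    [e^(c y + d tau)] the Cauchy problem becomes the heat equation for [W] with
    the source [s * K th z * (f0 z + th * f1 z)], so that [W] at time [tau] is
    [s] times a superposition over [z] of time convolutions of [K th z] and
    [th * K th z] with [K (tau - th) (y - z)]. These convolutions are elementary
    functions of [|z|] and of the sum [u = |z| + |y - z|], for instance
    [E u / sigma ^+ 2] for the first one ([potential0E], [potential1E]). They
    come from the addition rule for first passage times: the convolution of the
    passage densities at distances [a] and [v] is the one at distance [a + v]
    ([passage_convolution]).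

    As functions of [|y - z|] the potentials are smooth, with a corner at
    [y = z] that contributes a Dirac mass to the second derivative. Hence, in the
    sense of distributions ([source_potential_weak_derivative]),
      [W'' = - (2 s / sigma ^+ 2) K (f0 + tau f1) + s * (integral operator)],
    and since [u >= |y|] every kernel in the integral operator is controlled by
    [K] at [y]. Dividing by [2 s K / sigma ^+ 2] bounds [f0 + tau f1] by [W'']
    plus operators applied to [f0] and [f1], with explicit norms
    ([source_bound_at]).

    The two times [tau1] and [tau2] determine [f0] and [f1] from the two sums
    [f0 + tau_j f1]. In the norm [|f0| + sqrt (tau1 tau2) |f1|] the column sums
    of the resulting two by two system of operator norms are exactly the
    left-hand sides of the two smallness conditions ([contraction]), which
    gives the stability estimate ([stability]). For uniqueness the estimate is
    applied to the difference of two solutions: its potential vanishes on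
    [omega] at both times, so its second derivative is orthogonal to
    polynomial bumps and vanishes at every Lebesgue point
    ([ae_null_of_pairings]). *)

(** * Rules of derivation *)

Section derivation_rules.
Context {R : realType}.
Implicit Types (f g : R -> R) (x a b k : R).

Definition has_deriv f x a := is_derive x 1 f a.

Lemma has_deriv_eq f x a b : has_deriv f x a -> a = b -> has_deriv f x b.
Proof. by move=> ? <-. Qed.

Lemma has_deriv_cst k x : has_deriv (fun _ => k) x 0.
Proof. exact: is_derive_cst. Qed.

Lemma has_deriv_id x : has_deriv (fun u => u) x 1.
Proof. exact: is_derive_id. Qed.

Lemma has_derivD f g x a b : has_deriv f x a -> has_deriv g x b ->
  has_deriv (fun u => f u + g u) x (a + b).
Proof. by rewrite /has_deriv => *; exact: is_deriveD. Qed.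

Lemma has_derivN f x a : has_deriv f x a -> has_deriv (fun u => - f u) x (- a).
Proof. by rewrite /has_deriv => *; exact: is_deriveN. Qed.

Lemma has_derivM f g x a b : has_deriv f x a -> has_deriv g x b ->
  has_deriv (fun u => f u * g u) x (f x * b + g x * a).
Proof. by rewrite /has_deriv => *; exact: is_deriveM. Qed.

Lemma has_derivV f x a : f x != 0 -> has_deriv f x a ->
  has_deriv (fun u => (f u)^-1) x (- (f x) ^- 2 * a).
Proof. by rewrite /has_deriv => ? ?; exact: is_deriveV. Qed.

Lemma has_derivX f x a : has_deriv f x a ->
  has_deriv (fun u => f u ^+ 2) x (2 * f x * a).
Proof.
by move=> fa; apply: has_deriv_eq; [exact: (has_derivM fa fa)|ring].
Qed.

Lemma has_deriv_comp f g x a b : has_deriv f (g x) a -> has_deriv g x b ->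
  has_deriv (fun u => f (g u)) x (a * b).
Proof. by rewrite /has_deriv => ? ?; exact: is_derive1_comp. Qed.

Lemma has_deriv_expR f x a : has_deriv f x a ->
  has_deriv (fun u => expR (f u)) x (expR (f x) * a).
Proof. by move=> fa; apply: has_deriv_comp => //; exact: is_derive_expR. Qed.

Lemma has_deriv_sqrt f x a : 0 < f x -> has_deriv f x a ->
  has_deriv (fun u => Num.sqrt (f u)) x ((2 * Num.sqrt (f x))^-1 * a).
Proof.
by move=> f0 fa; apply: (has_deriv_comp _ fa); exact: is_derive1_sqrt.
Qed.

Lemma has_deriv_derivable f x a : has_deriv f x a -> derivable f x 1.
Proof. by move=> fa; exact: (@ex_derive _ _ _ _ _ _ _ fa). Qed.

Lemma has_deriv_derive1 f x a : has_deriv f x a -> derive1 f x = a.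
Proof. by move=> fa; rewrite derive1E (@derive_val _ _ _ _ _ _ _ fa). Qed.

Lemma has_deriv_continuous f x a : has_deriv f x a -> {for x, continuous f}.
Proof.
by move=> /has_deriv_derivable/derivable1_diffP; exact: differentiable_continuous.
Qed.

Lemma derive1_has_deriv f x : derivable f x 1 -> has_deriv f x (derive1 f x).
Proof. by move=> fx; rewrite derive1E; exact/derivableP. Qed.

Lemma has_deriv_nonincreasing f f' : (forall x, has_deriv f x (f' x)) ->
  (forall x, f' x <= 0) -> {homo f : x y /~ x <= y}.
Proof.
move=> df f0 y x xy; apply: (@ler0_derive1_nincr _ f x y) => //.
- by move=> z _; exact: has_deriv_derivable (df z).
- by move=> z _; rewrite (has_deriv_derive1 (df z)).
- by apply: continuous_subspaceT => z; exact: has_deriv_continuous (df z).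
Qed.

(** Beyond [a] the function decreases to its limit 0. *)
Lemma has_deriv_ge0 f f' a : (forall x, has_deriv f x (f' x)) ->
  (forall x, a <= x -> f' x <= 0) -> f x @[x --> +oo] --> (0 : R) ->
  forall x, a <= x -> 0 <= f x.
Proof.
move=> df f0 fy x ax; rewrite leNgt; apply/negP => fx.
have [N [_ NP]] : \forall y \near +oo, f x / 2 < f y.
  by apply: (cvgr_gt _ fy); lra.
have xy : x <= Num.max x (N + 1) by rewrite le_max lexx.
have : f (Num.max x (N + 1)) <= f x.
  apply: (@ler0_derive1_nincr _ f x (Num.max x (N + 1))) => //.
  - by move=> z _; exact: has_deriv_derivable (df z).
  - move=> z; rewrite in_itv/= => /andP[xz _]; rewrite (has_deriv_derive1 (df z)).
    by rewrite f0// (le_trans ax)// ltW.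
  - by apply: continuous_subspaceT => z; exact: has_deriv_continuous (df z).
have := NP (Num.max x (N + 1)); rewrite lt_max ltrDl ltr01 orbT => /(_ isT); lra.
Qed.

End derivation_rules.

(** * The Gaussian kernel and its tail *)

Section gaussian.
Context {R : realType}.
Local Notation mu := (@lebesgue_measure R).
Implicit Types (x y : R).

Definition gauss_cdf x : R := \int[mu]_(t in `]-oo, x]) gauss_fun t.

Lemma gauss_cdf_deriv x : has_deriv gauss_cdf x (gauss_fun x).
Proof.
have [] := @continuous_FTC1 R gauss_fun -oo%O x (x + 1); first by rewrite ltrDl.
- by apply: (integrableS _ _ (@subsetT _ _)) => //; exact: integrableT_gauss.
- exact: ltNyr.
- exact: continuous_gauss_fun.
by rewrite -/gauss_cdf => + <-; exact: derive1_has_deriv.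
Qed.

Import gauss_integral_proof.

Lemma cvg_gauss_cdf :
  gauss_cdf x @[x --> +oo] --> gauss_cdf 0 + Num.sqrt pi / 2.
Proof.
have cvg_Ig : @integral0_gauss R x @[x --> +oo] --> Num.sqrt pi / 2.
  have : Num.sqrt (@integral0_gauss R x ^+ 2) @[x --> +oo]
      --> Num.sqrt (pi / 4).
    apply: continuous_cvg => //;
      [exact: sqrt_continuous|exact: cvg_integral0_gauss_sqr].
  rewrite sqrtrM ?pi_ge0// sqrtrV// (_ : 4 = 2 ^+ 2); last by rewrite expr2; lra.
  rewrite sqrtr_sqr ger0_norm//.
  rewrite (_ : (fun _ => Num.sqrt _) = integral0_gauss)//.
  apply/funext => r; rewrite sqrtr_sqr// ger0_norm//.
  exact: integral0_gauss_ge0.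
apply: (@cvg_trans _ (gauss_cdf 0 + @integral0_gauss R x @[x --> +oo])); last first.
  by apply: cvgD => //; exact: cvg_cst.
apply: near_eq_cvg; near=> x.
have x0 : 0 <= x by [].
suff : gauss_cdf x - gauss_cdf 0 = integral0_gauss x.
  by move=> <-; rewrite addrC subrK.
rewrite /gauss_cdf Rintegral_itvB //.
  rewrite Rintegral_itv_obnd_cbnd //.
  by apply: (integrableS _ _ (@subsetT _ _)) => //; exact: integrableT_gauss.
by apply: (integrableS _ _ (@subsetT _ _)) => //; exact: integrableT_gauss.
Unshelve. all: by end_near. Qed.

(** The tail of the centred normal law of variance 1/2, written as a primitive
    so that it is a smooth function on the whole line. *)
Definition gauss_tail1 x : R :=
  1 / 2 + (gauss_cdf 0 - gauss_cdf x) / Num.sqrt pi.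

Lemma sqrt_pi_gt0 : 0 < Num.sqrt pi :> R.
Proof. by rewrite sqrtr_gt0 pi_gt0. Qed.

Lemma gauss_tail1_deriv x :
  has_deriv gauss_tail1 x (- (gauss_fun x / Num.sqrt pi)).
Proof.
rewrite /gauss_tail1; apply: has_deriv_eq.
  apply: has_derivD; first exact: has_deriv_cst.
  apply: has_derivM; last exact: has_deriv_cst.
  apply: has_derivD; first exact: has_deriv_cst.
  by apply: has_derivN; exact: gauss_cdf_deriv.
by rewrite /=; ring.
Qed.

Lemma cvg_gauss_tail1 : gauss_tail1 x @[x --> +oo] --> (0 : R).
Proof.
rewrite (_ : 0 = 1 / 2 + (gauss_cdf 0 - (gauss_cdf 0 + Num.sqrt pi / 2)) / Num.sqrt pi :> R); last first.
  by field; rewrite gt_eqF// sqrt_pi_gt0.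
rewrite /gauss_tail1; apply: cvgD; first exact: cvg_cst.
apply: cvgM; last exact: cvg_cst.
by apply: cvgB; [exact: cvg_cst|exact: cvg_gauss_cdf].
Qed.

Lemma gauss_tail10 : gauss_tail1 0 = 1 / 2.
Proof. by rewrite /gauss_tail1 subrr mul0r addr0. Qed.

Lemma gauss_tail1N x : gauss_tail1 (- x) = 1 - gauss_tail1 x.
Proof.
have : gauss_tail1 x + gauss_tail1 (- x) = gauss_tail1 0 + gauss_tail1 (- 0).
  apply: (is_derive_0_is_cst (f := fun x => gauss_tail1 x + gauss_tail1 (- x))).
  move=> z; apply: (@has_deriv_eq _ _ z).
    apply: has_derivD; first exact: gauss_tail1_deriv.
    apply: has_deriv_comp; first exact: gauss_tail1_deriv.
    by apply: has_derivN; exact: has_deriv_id.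
  by rewrite /gauss_fun sqrrN; ring.
rewrite oppr0 gauss_tail10; lra.
Qed.

End gaussian.

Section kernel.
Context {R : realType}.
Variables (sigma t : R).
Hypotheses (s0 : 0 < sigma) (t0 : 0 < t).
Local Notation mu := (@lebesgue_measure R).
Local Notation K := (gauss_kernel sigma t).
Local Notation m := (sigma ^+ 2 * t).
Implicit Types (x y u : R).

Lemma variance_gt0 : 0 < m. Proof. by rewrite mulr_gt0// exprn_gt0. Qed.
Local Hint Resolve variance_gt0 : core.

Lemma gauss_kernel_gt0 y : 0 < K y.
Proof.
by rewrite mulr_gt0 ?expR_gt0// invr_gt0 mulr_gt0// sqrtr_gt0 !mulr_gt0// pi_gt0.
Qed.

Lemma gauss_kernel_norm y : K `|y| = K y.
Proof. by rewrite /gauss_kernel -normrX ger0_norm// sqr_ge0. Qed.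

Lemma gauss_kernel_deriv y : has_deriv K y (- (y / m) * K y).
Proof.
rewrite /gauss_kernel; apply: has_deriv_eq.
  apply: has_derivM; first exact: has_deriv_cst.
  apply: has_deriv_expR; apply: has_derivN; apply: has_derivM; last exact: has_deriv_cst.
  by apply: has_derivX; exact: has_deriv_id.
rewrite /=; set a := _^-1; set b := expR _.
by field; rewrite !gt_eqF.
Qed.

Let width : R := sigma * Num.sqrt (2 * t).

Let width_gt0 : 0 < width.
Proof. by rewrite mulr_gt0// sqrtr_gt0 mulr_gt0. Qed.

Let widthE : width ^+ 2 = 2 * m.
Proof. by rewrite exprMn sqr_sqrtr ?mulr_ge0 ?(ltW t0)//; ring. Qed.

Let gauss_kernelE y : K y = gauss_fun (y / width) / Num.sqrt pi / width.
Proof.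
rewrite /gauss_kernel /gauss_fun [LHS]mulrC -[RHS]mulrA; congr (expR _ * _).
  by rewrite expr_div_n widthE; congr (- (_ / _)); ring.
rewrite -invfM /width -[2 * pi * t]mulrA [pi * t]mulrC mulrA sqrtrM ?mulr_ge0 ?(ltW t0)//.
by congr _^-1; ring.
Qed.

(** The primitive of [- K] that vanishes at infinity. *)
Definition gauss_tail u : R := gauss_tail1 (u / width).

Lemma gauss_tail_deriv u : has_deriv gauss_tail u (- K u).
Proof.
rewrite /gauss_tail; apply: has_deriv_eq.
  apply: has_deriv_comp; first exact: gauss_tail1_deriv.
  by apply: has_derivM; [exact: has_deriv_id|exact: has_deriv_cst].
by rewrite /= gauss_kernelE; ring.
Qed.

Lemma gauss_tail0 : gauss_tail 0 = 1 / 2.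
Proof. by rewrite /gauss_tail mul0r gauss_tail10. Qed.

Lemma gauss_tailN u : gauss_tail (- u) = 1 - gauss_tail u.
Proof. by rewrite /gauss_tail mulNr gauss_tail1N. Qed.

Lemma cvg_gauss_tail : gauss_tail u @[u --> +oo] --> (0 : R).
Proof.
apply: (cvg_comp (fun u => u / width) gauss_tail1); last exact: cvg_gauss_tail1.
apply: (gt0_cvgMly (f := fun u => u)); first by rewrite invr_gt0.
exact: cvg_id.
Qed.

Lemma gauss_tail_ge0 u : 0 <= gauss_tail u.
Proof.
apply: (has_deriv_ge0 gauss_tail_deriv _ cvg_gauss_tail (lexx u)).
by move=> x _; rewrite oppr_le0 ltW// gauss_kernel_gt0.
Qed.

Lemma gauss_tail_nincr : {homo gauss_tail : x y /~ x <= y}.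
Proof.
apply: has_deriv_nonincreasing; first exact: gauss_tail_deriv.
by move=> x; rewrite oppr_le0 ltW// gauss_kernel_gt0.
Qed.

End kernel.

Section kernel_decay.
Context {R : realType}.
Variables (sigma t : R).
Hypotheses (s0 : 0 < sigma) (t0 : 0 < t).
Local Notation K := (gauss_kernel sigma t).
Local Notation E := (gauss_tail sigma t).
Local Notation m := (sigma ^+ 2 * t).
Implicit Types (x y u : R).

Let m0 : 0 < m. Proof. exact: variance_gt0. Qed.

Lemma cvg_sqr_gauss_kernel : u ^+ 2 * K u @[u --> +oo] --> (0 : R).
Proof.
have kE u : K u = K 0 * expR (- (u ^+ 2 / (2 * m))).
  rewrite /gauss_kernel expr0n/= mul0r oppr0 expR0 mulr1; congr (_ * expR (- (_ / _))).
  by ring.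
have c0 : 8 * m ^+ 2 * K 0 / u @[u --> +oo] --> (0 : R).
  rewrite -[X in _ --> X](mulr0 (8 * m ^+ 2 * K 0)).
  apply: cvgM; first exact: cvg_cst.
  by apply/gtr0_cvgV0; [exact: nbhs_pinfty_gt|exact: cvg_id].
apply: (squeeze_cvgr _ (cvg_cst 0) c0).
near=> u.
have u1 : 1 <= u by [].
have u0 : 0 < u by lra.
rewrite mulr_ge0 ?sqr_ge0 ?(ltW (gauss_kernel_gt0 s0 t0 _))//=.
set x := u ^+ 2 / (2 * m); have x0 : 0 < x by rewrite divr_gt0 ?exprn_gt0// mulr_gt0.
have ex : expR (- x) <= 2 / x ^+ 2.
  rewrite expRN -[2 / _]invrK lef_pV2 ?posrE ?expR_gt0 ?invr_gt0 ?divr_gt0 ?exprn_gt0//.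
  rewrite invfM invrK mulrC.
  have := expR_ge1Dxn 1 (ltW x0).
  by rewrite (_ : 2`!%:R = 2)//; lra.
rewrite kE -/x; apply: (@le_trans _ _ (u ^+ 2 * (K 0 * (2 / x ^+ 2)))).
  by rewrite !ler_pM2l ?exprn_gt0 ?gauss_kernel_gt0.
have -> : u ^+ 2 * (K 0 * (2 / x ^+ 2)) = 8 * m ^+ 2 * K 0 / u ^+ 2.
  by rewrite /x; field; rewrite !gt_eqF.
rewrite ler_pM2l; last by rewrite pmulr_lgt0 ?gauss_kernel_gt0// mulr_gt0// exprn_gt0.
by rewrite lef_pV2 ?posrE ?exprn_gt0// expr2 ler_peMl// ltW.
Unshelve. all: by end_near. Qed.

Lemma cvg_pow_gauss_kernel n : (n <= 2)%N -> u ^+ n * K u @[u --> +oo] --> (0 : R).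
Proof.
move=> n2; apply: (squeeze_cvgr _ (cvg_cst 0) cvg_sqr_gauss_kernel).
near=> u; have u1 : 1 <= u by [].
rewrite mulr_ge0 ?exprn_ge0 ?(ltW (gauss_kernel_gt0 s0 t0 _))//= ?(le_trans _ u1)//.
by rewrite ler_pM2r ?gauss_kernel_gt0// ler_weXn2l.
Unshelve. all: by end_near. Qed.

(** [m K - E] is nonincreasing beyond 1, because the derivative of [K] is
    [- u K / m]. *)
Lemma gauss_tail_le_kernel u : 1 <= u -> E u <= m * K u.
Proof.
move=> u1; rewrite -subr_ge0.
apply: (@has_deriv_ge0 _ (fun u => m * K u - E u) (fun u => - (u - 1) * K u) 1 _ _ _ u u1).
- move=> x; apply: has_deriv_eq.
    apply: has_derivD; last by apply: has_derivN; exact: gauss_tail_deriv.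
    by apply: has_derivM; [exact: has_deriv_cst|exact: gauss_kernel_deriv].
  by rewrite /=; field; rewrite !gt_eqF.
- move=> x x1; rewrite mulNr oppr_le0 mulr_ge0// ?subr_ge0//.
  by rewrite ltW// gauss_kernel_gt0.
- rewrite -[X in _ --> X]subr0; apply: cvgB; last exact: cvg_gauss_tail.
  rewrite -[X in _ --> X](mulr0 m); apply: cvgM; first exact: cvg_cst.
  have := @cvg_pow_gauss_kernel 0 isT.
  by under eq_fun do rewrite expr0 mul1r.
Qed.

Lemma cvg_pow_gauss_tail n : (n <= 2)%N -> u ^+ n * E u @[u --> +oo] --> (0 : R).
Proof.
move=> n2.
have c0 : m * (u ^+ n * K u) @[u --> +oo] --> (0 : R).
  rewrite -[X in _ --> X](mulr0 m); apply: cvgM; first exact: cvg_cst.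
  exact: cvg_pow_gauss_kernel.
apply: (squeeze_cvgr _ (cvg_cst 0) c0).
near=> u; have u1 : 1 <= u by [].
rewrite mulr_ge0 ?exprn_ge0 ?gauss_tail_ge0//= ?(le_trans _ u1)//.
by rewrite mulrCA ler_wpM2l ?gauss_tail_le_kernel// exprn_ge0.
Unshelve. all: by end_near. Qed.

(** The iterated integrals of the tail over the half line beyond [u]. *)
Definition gauss_tail2 u : R := m * K u - u * E u.
Definition gauss_tail3 u : R := ((u ^+ 2 + m) * E u - m * u * K u) / 2.

Lemma gauss_tail2_deriv u : has_deriv gauss_tail2 u (- E u).
Proof.
apply: has_deriv_eq.
  apply: has_derivD.
    by apply: has_derivM; [exact: has_deriv_cst|exact: gauss_kernel_deriv].
  apply: has_derivN; apply: has_derivM; first exact: has_deriv_id.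
  exact: gauss_tail_deriv.
by rewrite /=; field; rewrite !gt_eqF.
Qed.

Lemma gauss_tail3_deriv u : has_deriv gauss_tail3 u (- gauss_tail2 u).
Proof.
apply: has_deriv_eq.
  apply: has_derivM; last exact: has_deriv_cst.
  apply: has_derivD.
    apply: has_derivM; last exact: gauss_tail_deriv.
    apply: has_derivD; last exact: has_deriv_cst.
    by apply: has_derivX; exact: has_deriv_id.
  apply: has_derivN; apply: has_derivM; last exact: gauss_kernel_deriv.
  by apply: has_derivM; [exact: has_deriv_cst|exact: has_deriv_id].
by rewrite /gauss_tail2 /=; field; rewrite !gt_eqF.
Qed.

Lemma cvg_gauss_tail2 : gauss_tail2 u @[u --> +oo] --> (0 : R).
Proof.
rewrite /gauss_tail2 -[X in _ --> X](_ : m * 0 - 0 = 0); last by ring.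
apply: cvgB.
  apply: cvgM; first exact: cvg_cst.
  by have := @cvg_pow_gauss_kernel 0 isT; under eq_fun do rewrite expr0 mul1r.
by have := @cvg_pow_gauss_tail 1 isT; under eq_fun do rewrite expr1.
Qed.

Lemma gauss_tail2_ge0 u : 0 <= gauss_tail2 u.
Proof.
apply: (has_deriv_ge0 gauss_tail2_deriv _ cvg_gauss_tail2 (lexx u)).
by move=> x _; rewrite oppr_le0 gauss_tail_ge0.
Qed.

(** The Mills ratio [E / K] decreases, its derivative having the sign of
    [- gauss_tail2]; its value at 0 is [sigma sqrt (2 pi t) / 2]. *)
Lemma gauss_tail_le_mills y : 0 <= y ->
  E y <= sigma * Num.sqrt (2 * pi * t) / 2 * K y.
Proof.
move=> y0; have K0 x : K x != 0 by rewrite gt_eqF// gauss_kernel_gt0.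
have : E y / K y <= E 0 / K 0.
  apply: (@has_deriv_nonincreasing _ (fun u => E u / K u)
     (fun u => - (gauss_tail2 u / (m * K u))) _ _ y 0 y0) => x.
    apply: has_deriv_eq.
      apply: has_derivM; first exact: gauss_tail_deriv.
      by apply: has_derivV; [exact: K0|exact: gauss_kernel_deriv].
    by rewrite /gauss_tail2 /=; field; rewrite K0 !gt_eqF.
  rewrite oppr_le0 divr_ge0 ?gauss_tail2_ge0// mulr_ge0 ?(ltW m0)//.
  by rewrite ltW// gauss_kernel_gt0.
rewrite ler_pdivrMr ?gauss_kernel_gt0// => /le_trans; apply.
rewrite ler_pM2r ?gauss_kernel_gt0//.
rewrite gauss_tail0 /gauss_kernel expr0n/= mul0r oppr0 expR0 mulr1 invrK.
by rewrite le_eqVlt; apply/orP; left; apply/eqP; ring.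
Qed.

End kernel_decay.

(** * A fundamental theorem of calculus on open intervals *)

Section FTC_open.
Context {R : realType}.
Local Notation mu := (@lebesgue_measure R).

(** Exhaustion by compact subintervals: only the primitive needs limits at the
    end points, where the integrand may be unbounded. *)
Lemma ge0_FTC2_oo (f F : R -> R) (a b l L : R) : a < b ->
  (forall x, a < x < b -> 0 <= f x) ->
  (forall x, a < x < b -> has_deriv F x (f x)) ->
  (forall x, a < x < b -> {for x, continuous f}) ->
  F x @[x --> a^'+] --> l -> F x @[x --> b^'-] --> L ->
  (\int[mu]_(x in `]a, b[) (f x)%:E = (L - l)%:E)%E.
Proof.
move=> ab f0 dF cf Fa Fb.
pose e (n : nat) := (b - a) / 3 * harmonic n.
have d0 : 0 < (b - a) / 3 by rewrite divr_gt0// subr_gt0.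
have e0 n : 0 < e n by rewrite mulr_gt0// invr_gt0.
have e3 n : e n <= (b - a) / 3 by rewrite /e ger_pMr// invf_le1// ler1n.
have eS n : e n.+1 <= e n by rewrite ler_pM2l// lef_pV2 ?posrE// ler_nat.
have ecvg : e n @[n --> \oo] --> 0.
  rewrite -[X in _ --> X](mulr0 ((b - a) / 3)); apply: cvgM; first exact: cvg_cst.
  exact: cvg_harmonic.
pose I n : set R := `[a + e n, b - e n]%classic.
have Ioo n x : I n x -> a < x < b.
  rewrite /I/= in_itv/= => /andP[ax xb].
  by rewrite (lt_le_trans _ ax) ?ltrDl// (le_lt_trans xb)// ltrBlDr ltrDl.
have UI : \bigcup_i I i = `]a, b[%classic.
  apply/seteqP; split => [x [n _ /Ioo]|x]; first by rewrite /= in_itv/=.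
  rewrite /= in_itv/= => /andP[ax xb].
  have [N _ NP] : \forall n \near \oo, e n < Num.min (x - a) (b - x).
    by apply: (cvgr_lt _ ecvg); rewrite lt_min !subr_gt0 ax xb.
  exists N => //; have := NP N (leqnn N); rewrite /= lt_min /I/= in_itv/=.
  by move=> /andP[? ?]; apply/andP; split; lra.
have mf : measurable_fun `]a, b[ f.
  apply: open_continuous_measurable_fun => //.
  by move=> x; rewrite inE/= in_itv/=; exact: cf.
have cI : (\int[mu]_(x in I n) (f x)%:E @[n --> \oo]
    --> \int[mu]_(x in `]a, b[) (f x)%:E)%E.
  rewrite -UI; apply: ge0_nondecreasing_set_cvg_integral.
  - apply/nondecreasing_seqP => n; apply/subsetPset; apply: subset_itv; rewrite bnd_simp.
      by rewrite lerD2l.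
    by rewrite lerD2l lerN2.
  - by move=> n; exact: measurable_itv.
  - move=> n; apply/measurable_EFinP; apply: measurable_funS mf => // x /Ioo.
    by rewrite /= in_itv.
  - by move=> n x /Ioo xab; rewrite lee_fin f0.
apply: (cvg_unique _ cI) => //.
have EI n : (\int[mu]_(x in I n) (f x)%:E = (F (b - e n) - F (a + e n))%:E)%E.
  have abn : a + e n < b - e n by have := e3 n; have := e0 n; lra.
  rewrite (@continuous_FTC2 _ f F) ?EFinB//.
  - apply/continuous_in_subspaceT => x; rewrite inE => xI.
    by apply: cf; exact: Ioo xI.
  - split.
    + move=> x xI; apply: (@has_deriv_derivable _ _ _ (f x)); apply: dF; apply: (Ioo n).
      by apply: subset_itv_oo_cc.
    + apply: cvg_at_right_filter; apply: (@has_deriv_continuous _ _ _ (f (a + e n))).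
      by apply: dF; apply: (Ioo n); rewrite /I/= in_itv/= lexx ltW.
    + apply: cvg_at_left_filter; apply: (@has_deriv_continuous _ _ _ (f (b - e n))).
      by apply: dF; apply: (Ioo n); rewrite /I/= in_itv/= lexx ltW.
  - move=> x xI; apply: has_deriv_derive1; apply: dF; apply: (Ioo n).
    by apply: subset_itv_oo_cc.
rewrite (_ : (fun i => _) = (fun n => (F (b - e n) - F (a + e n))%:E)); last first.
  by apply/funext => n; exact: EI.
apply: cvg_EFin; first exact: nearW.
apply: cvgB.
  apply: (cvg_at_leftP _ _ _).1 Fb _ _; split.
    by move=> n; rewrite ltrBlDr ltrDl.
  rewrite -[X in _ --> X]subr0; apply: cvgB => //; exact: cvg_cst.
apply: (cvg_at_rightP _ _ _).1 Fa _ _; split.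
  by move=> n; rewrite ltrDl.
rewrite -[X in _ --> X]addr0; apply: cvgD => //; exact: cvg_cst.
Unshelve. all: by end_near. Qed.

End FTC_open.

(** * Time convolutions of Gaussian kernels *)

Section measurability.
Context {R : realType} d (T : measurableType d).
Implicit Types f g : T -> R.

Lemma measurable_funV f : measurable_fun setT f ->
  measurable_fun setT (fun x => (f x)^-1).
Proof.
move=> mf.
rewrite (_ : (fun _ => _) = (fun x => f x * (f x ^+ 2) `^ (-1))).
  apply: measurable_funM => //.
  apply: (measurableT_comp (@measurable_powR R (-1))).
  exact: measurable_funX.
apply/funext => x; rewrite powR_inv1 ?sqr_ge0//.
have [->|f0] := eqVneq (f x) 0; first by rewrite invr0 mul0r.
by rewrite expr2 invfM mulrA mulfV// mul1r.
Qed.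

Lemma measurable_gauss_kernel (sigma : R) f g :
  measurable_fun setT f -> measurable_fun setT g ->
  measurable_fun setT (fun x => gauss_kernel sigma (f x) (g x)).
Proof.
move=> mf mg; apply: measurable_funM.
  apply: measurable_funV; apply: measurable_funM => //.
  have msqrt : measurable_fun setT (@Num.sqrt R).
    by apply: continuous_measurable_fun; exact: sqrt_continuous.
  by apply: (measurableT_comp msqrt); exact: measurable_funM.
apply: (measurableT_comp (@measurable_expR R)).
apply: measurableT_comp => //; apply: measurable_funM.
  exact: measurable_funX.
apply: measurable_funV; apply: measurable_funM => //.
exact: measurable_funM.
Qed.

End measurability.

Section convolution.
Context {R : realType}.
Variables (sigma tau : R).
Hypotheses (s0 : 0 < sigma) (tau0 : 0 < tau).
Local Notation mu := (@lebesgue_measure R).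
Local Notation K := (gauss_kernel sigma).
Local Notation E := (gauss_tail sigma tau).
Local Notation m := (sigma ^+ 2 * tau).
Implicit Types (a v c w th : R).

Let m0 : 0 < m. Proof. exact: variance_gt0. Qed.

(** Completing the square in [a ^+ 2 / p ^+ 2 + v ^+ 2 / q ^+ 2] when
    [p ^+ 2 + q ^+ 2 = tau]. *)
Lemma gauss_kernel_mul a v p q : 0 < p -> 0 < q -> p ^+ 2 + q ^+ 2 = tau ->
  K (p ^+ 2) a * K (q ^+ 2) v
  = K tau (a + v) * K tau (v * (p / q) - a / (p / q)) * (tau / (p * q)).
Proof.
move=> p0 q0 pq; rewrite /gauss_kernel.
have sq x : 0 < x -> Num.sqrt (2 * pi * x ^+ 2) = Num.sqrt (2 * pi) * x.
  by move=> x0; rewrite sqrtrM ?mulr_ge0 ?pi_ge0// sqrtr_sqr gtr0_norm.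
rewrite !sq// [Num.sqrt (2 * pi * tau)]sqrtrM ?mulr_ge0 ?pi_ge0//.
have st0 : 0 < Num.sqrt tau by rewrite sqrtr_gt0.
have stE : Num.sqrt tau ^+ 2 = tau by rewrite sqr_sqrtr ?ltW.
have P0 : 0 < Num.sqrt (2 * pi) :> R by rewrite sqrtr_gt0 mulr_gt0 ?pi_gt0.
set r := Num.sqrt tau in st0 stE *; set P := Num.sqrt _ in P0 *.
rewrite mulrACA [X in _ = X * _]mulrACA -!expRD [RHS]mulrAC.
congr (_ * expR _).
  by rewrite -stE; field; rewrite !gt_eqF.
by rewrite -pq; field; rewrite !gt_eqF// addr_gt0 ?exprn_gt0.
Qed.

Lemma cvg_gauss_tail_inv (F : set_system R) {FF : Filter F} (r : R -> R) al de :
  0 < al -> (\forall x \near F, 0 < r x) -> r x @[x --> F] --> (0 : R) ->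
  E (al / r x + de * r x) @[x --> F] --> (0 : R).
Proof.
move=> al0 r0 rF.
apply: (cvg_comp (fun x => al / r x + de * r x) E); last exact: cvg_gauss_tail.
have iF : (r x)^-1 @[x --> F] --> +oo by apply/cvgrVy.
apply: (@ger_cvgy _ _ _ _ (fun x => al * (r x)^-1 + - `|de|)).
  near=> x; rewrite lerD2l.
  have x0 : 0 < r x by near: x.
  have x1 : r x <= 1 by near: x; apply: (cvgr_le _ rF).
  rewrite (@le_trans _ _ (- (`|de| * r x)))//.
    by rewrite lerN2 ler_piMr.
  by rewrite -mulNr ler_wpM2r ?(ltW x0)// lerNl -normrN ler_norm.
apply: (cvg_comp (fun x => al * (r x)^-1) (fun y => y + - `|de|)).
  exact: gt0_cvgMry.
exact: cvg_addrr.
Unshelve. all: by end_near. Qed.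

(** The factor [v / (sigma ^+ 2 * (tau - th))] turns the second kernel into a
    multiple of a first passage density; with it the time convolution has an
    elementary primitive in terms of [sqrt (th / (tau - th))]. *)
Lemma passage_convolution a v : 0 < a -> 0 < v ->
  (\int[mu]_(th in `]0%R, tau[)
     (K th a * (v / (sigma ^+ 2 * (tau - th)) * K (tau - th) v))%:E
   = (K tau (a + v) / sigma ^+ 2)%:E)%E.
Proof.
move=> a0 v0.
(* In the variable rho the square completed in gauss_kernel_mul is that of
   v rho - a / rho, whose derivative has the unwanted term a / rho ^+ 2; the
   second summand of F removes it, because w exchanges the values of K at
   v rho + a / rho and v rho - a / rho. *)
pose rho th := Num.sqrt th / Num.sqrt (tau - th).
pose C := K tau (a + v) / sigma ^+ 2.
pose w := expR (2 * a * v / m).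
pose F th := - C * (E (v * rho th - a / rho th) + w * E (v * rho th + a / rho th)).
have gt0 th : 0 < th < tau -> 0 < Num.sqrt th /\ 0 < Num.sqrt (tau - th).
  by move=> /andP[h0 h1]; rewrite !sqrtr_gt0 subr_gt0.
have sqE th : 0 < th < tau ->
    Num.sqrt th ^+ 2 = th /\ Num.sqrt (tau - th) ^+ 2 = tau - th.
  by move=> /andP[h0 h1]; rewrite !sqr_sqrtr ?subr_ge0 ?ltW.
have drho th : 0 < th < tau ->
    has_deriv rho th (tau / (2 * Num.sqrt th * Num.sqrt (tau - th) ^+ 3)).
  move=> ht; have [p0 q0] := gt0 _ ht; have [pE qE] := sqE _ ht.
  have tE : tau = Num.sqrt th ^+ 2 + Num.sqrt (tau - th) ^+ 2 by rewrite pE qE; ring.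
  apply: has_deriv_eq.
    apply: has_derivM.
      by apply: has_deriv_sqrt; [by case/andP : ht|exact: has_deriv_id].
    apply: has_derivV; first by rewrite gt_eqF.
    apply: has_deriv_sqrt; first by rewrite subr_gt0; case/andP : ht.
    apply: has_derivD; first exact: has_deriv_cst.
    by apply: has_derivN; exact: has_deriv_id.
  rewrite /=; move: tE; set p := Num.sqrt th in p0 *.
  set q := Num.sqrt (tau - th) in q0 * => tE.
  by rewrite {1}tE; field; rewrite !gt_eqF.
have kE x y : y = x + 4 * a * v -> 0 <= x -> 
    w * K tau (Num.sqrt y) = K tau (Num.sqrt x).
  move=> -> x0; rewrite /gauss_kernel !sqr_sqrtr//; last by rewrite addr_ge0// !mulr_ge0// ltW.
  rewrite mulrCA /w -expRD; congr (_ * expR _).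
  by field; rewrite !gt_eqF.
have wK x : 0 < x -> w * K tau (v * x + a / x) = K tau (v * x - a / x).
  move=> x0; rewrite -(gauss_kernel_norm _ _ (v * x + _)) -(gauss_kernel_norm _ _ (v * x - _)).
  rewrite -!sqrtr_sqr; apply: kE; last exact: sqr_ge0.
  by field; rewrite gt_eqF.
have dF th : 0 < th < tau -> has_deriv F th
    (K th a * (v / (sigma ^+ 2 * (tau - th)) * K (tau - th) v)).
  move=> ht; have [p0 q0] := gt0 _ ht; have [pE qE] := sqE _ ht.
  have tE : Num.sqrt th ^+ 2 + Num.sqrt (tau - th) ^+ 2 = tau by rewrite pE qE; ring.
  have r0 : 0 < rho th by rewrite divr_gt0.
  apply: has_deriv_eq.
    apply: has_derivM; first exact: has_deriv_cst.
    apply: has_derivD.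
      apply: has_deriv_comp; first exact: gauss_tail_deriv.
      apply: has_derivD.
        by apply: has_derivM; [exact: has_deriv_cst|exact: drho].
      apply: has_derivN; apply: has_derivM; first exact: has_deriv_cst.
      by apply: has_derivV; [rewrite gt_eqF|exact: drho].
    apply: has_derivM; first exact: has_deriv_cst.
    apply: has_deriv_comp; first exact: gauss_tail_deriv.
    apply: has_derivD.
      by apply: has_derivM; [exact: has_deriv_cst|exact: drho].
    apply: has_derivM; first exact: has_deriv_cst.
    by apply: has_derivV; [rewrite gt_eqF|exact: drho].
  rewrite /=.
  have Kd : w * K tau (v * rho th + a / rho th) = K tau (v * rho th - a / rho th).
    exact: wK.
  have := gauss_kernel_mul a v p0 q0 tE; rewrite pE qE -/(rho th) => KK.
  transitivity (C * K tau (v * rho th - a / rho th) *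
     (2 * v * (tau / (2 * Num.sqrt th * Num.sqrt (tau - th) ^+ 3)))).
    rewrite -[in RHS]Kd -Kd; ring.
  have -> : v / (sigma ^+ 2 * (tau - th)) = v / (sigma ^+ 2 * Num.sqrt (tau - th) ^+ 2).
    by rewrite qE.
  rewrite [RHS]mulrCA KK /C.
  by field; rewrite !gt_eqF.
have s2 : 0 < sigma ^+ 2 by rewrite exprn_gt0.
have ctn_sqrt (f : R -> R) (x : R) : {for x, continuous f} ->
    {for x, continuous (fun y => Num.sqrt (f y))}.
  by move=> cf; apply: continuous_comp => //; exact: sqrt_continuous.
have ctn_lin (x : R) : {for x, continuous (fun y => tau - y)}.
  by apply: cvgB; [exact: cvg_cst|exact: cvg_id].
have p_at0 : Num.sqrt th @[th --> (0:R)^'+] --> (0 : R).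
  by apply: cvg_at_right_filter; rewrite -[X in _ --> X]sqrtr0; exact: sqrt_continuous.
have q_at0 : Num.sqrt (tau - th) @[th --> (0:R)^'+] --> Num.sqrt tau.
  by apply: cvg_at_right_filter; rewrite -[X in _ --> Num.sqrt X]subr0; exact: (ctn_sqrt _ _ (ctn_lin _)).
have p_at1 : Num.sqrt th @[th --> tau^'-] --> Num.sqrt tau.
  by apply: cvg_at_left_filter; exact: sqrt_continuous.
have q_at1 : Num.sqrt (tau - th) @[th --> tau^'-] --> (0 : R).
  apply: cvg_at_left_filter.
  by rewrite -[X in _ --> X]sqrtr0 -[X in _ --> Num.sqrt X](subrr tau); exact: (ctn_sqrt _ _ (ctn_lin _)).
have st0 : Num.sqrt tau != 0 by rewrite gt_eqF// sqrtr_gt0.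
have rho_at0 : rho th @[th --> (0:R)^'+] --> (0 : R).
  rewrite -[X in _ --> X](mul0r (Num.sqrt tau)^-1).
  by apply: cvgM => //; exact: cvgV.
have rhoV_at1 : (rho th)^-1 @[th --> tau^'-] --> (0 : R).
  rewrite (_ : (fun _ => _) = fun th => Num.sqrt (tau - th) / Num.sqrt th); last first.
    by apply/funext => th; rewrite /rho invf_div.
  rewrite -[X in _ --> X](mul0r (Num.sqrt tau)^-1).
  by apply: cvgM => //; exact: cvgV.
have F0 : F th @[th --> (0:R)^'+] --> - C.
  rewrite -[X in _ --> X](_ : - C * (1 - 0 + w * 0) = - C); last by ring.
  apply: cvgM; first exact: cvg_cst.
  have rg : \forall x \near 0^'+, 0 < rho x.
    near=> x; have := gt0 x; case=> [|? ?]; last by rewrite divr_gt0.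
    by apply/andP; split => //; near: x; exact: nbhs_right_lt.
  apply: cvgD.
    rewrite (_ : (fun _ => _) = fun th => 1 - E (a / rho th + - v * rho th)); last first.
      apply/funext => th; rewrite -gauss_tailN; congr E; ring.
    by apply: cvgB; [exact: cvg_cst|exact: cvg_gauss_tail_inv].
  apply: cvgM; first exact: cvg_cst.
  by under eq_fun do rewrite addrC; exact: cvg_gauss_tail_inv.
have F1 : F th @[th --> tau^'-] --> 0.
  rewrite -[X in _ --> X](_ : - C * (0 + w * 0) = 0); last by ring.
  apply: cvgM; first exact: cvg_cst.
  have rg : \forall x \near tau^'-, 0 < (rho x)^-1.
    near=> x; have := gt0 x; case=> [|? ?]; last by rewrite invr_gt0 divr_gt0.
    by apply/andP; split => //; near: x; exact: nbhs_left_gt.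
  apply: cvgD.
    rewrite (_ : (fun _ => _) = fun th => E (v / (rho th)^-1 + - a * (rho th)^-1)); last first.
      by apply/funext => th; rewrite invrK mulNr.
    exact: cvg_gauss_tail_inv.
  apply: cvgM; first exact: cvg_cst.
  rewrite (_ : (fun _ => _) = fun th => E (v / (rho th)^-1 + a * (rho th)^-1)); last first.
    by apply/funext => th; rewrite invrK.
  exact: cvg_gauss_tail_inv.
rewrite (ge0_FTC2_oo tau0 _ dF _ F0 F1) ?sub0r ?opprK//.
  move=> x xI; have /andP[x0 x1] := xI.
  have tx : 0 < tau - x by rewrite subr_gt0.
  apply: mulr_ge0; first exact/ltW/gauss_kernel_gt0.
  apply: mulr_ge0; last exact/ltW/gauss_kernel_gt0.
  by apply: divr_ge0; [exact: ltW|exact/ltW/variance_gt0].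
move=> x xI; have /andP[x0 x1] := xI.
have tx : 0 < tau - x by rewrite subr_gt0.
have ck (f : R -> R) y : {for x, continuous f} -> 0 < f x ->
    {for x, continuous (fun th => K (f th) y)}.
  move=> cf fx; rewrite /gauss_kernel.
  apply: cvgM.
    apply: cvgV; first by rewrite gt_eqF// mulr_gt0// sqrtr_gt0 !mulr_gt0// pi_gt0.
    apply: cvgM; last exact: cvg_cst.
    apply: (ctn_sqrt (fun th => 2 * pi * f th)); apply: cvgM => //; exact: cvg_cst.
  apply: (@continuous_comp _ _ _ (fun th => - (y ^+ 2 / (2 * f th * sigma ^+ 2))) expR);
    last exact: continuous_expR.
  apply: cvgN; apply: cvgM; first exact: cvg_cst.
  apply: cvgV; first by rewrite gt_eqF// !mulr_gt0.
  by apply: cvgM; [apply: cvgM => //|]; exact: cvg_cst.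
apply: cvgM; first by apply: (ck (fun th => th)) => //; exact: cvg_id.
apply: cvgM; last exact: (ck (fun th => tau - th)).
apply: cvgM; first exact: cvg_cst.
apply: cvgV; first by rewrite gt_eqF// mulr_gt0.
by apply: cvgM; [exact: cvg_cst|exact: ctn_lin].
Unshelve. all: by end_near. Qed.

End convolution.

Section tonelli.
Context {R : realType}.
Local Notation mu := (@lebesgue_measure R).

Lemma tonelli_in (D1 D2 : set R) (g : R * R -> R) :
  measurable D1 -> measurable D2 -> measurable_fun setT g ->
  (forall x y, D1 x -> D2 y -> 0 <= g (x, y)) ->
  (\int[mu]_(x in D1) \int[mu]_(y in D2) (g (x, y))%:E
   = \int[mu]_(y in D2) \int[mu]_(x in D1) (g (x, y))%:E)%E.
Proof.
move=> m1 m2 mg g0.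
pose h := (g \_ (D1 `*` D2)).
have h0 x : 0 <= h x.
  by rewrite /h patchE; case: ifPn => //; rewrite inE => -[]; case: x => x y; exact: g0.
have mh : measurable_fun setT (EFin \o h).
  apply/measurable_EFinP; apply/(measurable_restrictT _ _).1.
    exact: measurableX.
  exact: measurable_funS mg.
have h1 x y : D1 x -> h (x, y) = ((fun y => g (x, y)) \_ D2) y.
  move=> xD; rewrite /h !patchE; congr (if _ then _ else _).
  by apply/idP/idP; rewrite !inE => //=; case.
have h1N x y : ~ D1 x -> h (x, y) = 0.
  by move=> xD; rewrite /h patchE memNset//=; case.
have h2 x y : D2 y -> h (x, y) = ((fun x => g (x, y)) \_ D1) x.
  move=> xD; rewrite /h !patchE; congr (if _ then _ else _).
  by apply/idP/idP; rewrite !inE => //=; case.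
have h2N x y : ~ D2 y -> h (x, y) = 0.
  by move=> xD; rewrite /h patchE memNset//=; case.
transitivity (\int[mu]_x \int[mu]_y (h (x, y))%:E)%E.
  rewrite integral_mkcond; apply: eq_integral => x _.
  rewrite patchE; case: ifPn => [|/negP]; rewrite inE => xD.
    rewrite integral_mkcond; apply: eq_integral => y _.
    by rewrite restrict_EFin /= h1.
  by rewrite integral0_eq// => y _; rewrite h1N.
transitivity (\int[mu]_y \int[mu]_x (h (x, y))%:E)%E.
  have h0' : forall x, (0%R <= (EFin \o h) x)%E by move=> x; rewrite lee_fin.
  exact: (@fubini_tonelli _ _ _ _ R lebesgue_measure lebesgue_measure _ mh h0').
rewrite [RHS]integral_mkcond; apply: eq_integral => y _.
rewrite patchE; case: ifPn => [|/negP]; rewrite inE => yD.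
  rewrite [RHS]integral_mkcond; apply: eq_integral => x _.
  by rewrite restrict_EFin /= h2.
by rewrite integral0_eq// => x _; rewrite h2N.
Qed.

End tonelli.

Section source_kernels.
Context {R : realType}.
Variables (sigma : R).
Hypotheses (s0 : 0 < sigma).
Local Notation mu := (@lebesgue_measure R).
Local Notation K := (gauss_kernel sigma).
Implicit Types (a v c w th tau : R).

Let ctn_K t v : 0 < t -> {for v, continuous (K t)}.
Proof. by move=> t0; exact: has_deriv_continuous (gauss_kernel_deriv s0 t0 v). Qed.

Let cvg_K t : 0 < t -> K t u @[u --> +oo] --> (0 : R).
Proof.
move=> t0; have := @cvg_pow_gauss_kernel _ _ _ s0 t0 0 isT.
by under eq_fun do rewrite expr0 mul1r.
Qed.

Lemma gauss_kernel_passage t c : 0 < t -> 0 <= c ->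
  (\int[mu]_(v in `[c, +oo[) (v / (sigma ^+ 2 * t) * K t v)%:E = (K t c)%:E)%E.
Proof.
move=> t0 c0; have s2t := variance_gt0 s0 t0.
have dF x : has_deriv (fun x => - K t x) x (x / (sigma ^+ 2 * t) * K t x).
  apply: has_deriv_eq; first by apply: has_derivN; exact: gauss_kernel_deriv.
  by rewrite mulNr opprK.
rewrite (@ge0_continuous_FTC2y _ _ (fun x => - K t x) c 0).
- by rewrite EFinN oppeK add0e.
- move=> x cx; apply: mulr_ge0; last exact/ltW/gauss_kernel_gt0.
  by apply: divr_ge0; [exact: le_trans cx|exact: ltW].
- apply: continuous_subspaceT => x; apply: cvgM; last exact: ctn_K.
  by apply: cvgM; [exact: cvg_id|exact: cvg_cst].
- by rewrite -[X in _ --> X]oppr0; apply: cvgN; exact: cvg_K.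
- by move=> x _; exact: has_deriv_derivable (dF x).
- by apply: cvg_at_right_filter; exact: has_deriv_continuous (dF c).
- by move=> x _; exact: has_deriv_derive1 (dF x).
Qed.

Section fixed_time.
Variable tau : R.
Hypothesis tau0 : 0 < tau.
Local Notation E := (gauss_tail sigma tau).
Local Notation E2 := (gauss_tail2 sigma tau).
Local Notation E3 := (gauss_tail3 sigma tau).
Local Notation m := (sigma ^+ 2 * tau).

(** The heat potentials, at distance [c] and time [tau], of point sources of
    intensity [K th a] and [th * K th a] at the times [th < tau]. *)
Definition potential0 a c : R := E (a + c) / sigma ^+ 2.
Definition potential1 a c : R := (a * E2 (a + c) + E3 (a + c)) / sigma ^+ 4.

Let s2 : 0 < sigma ^+ 2. Proof. by rewrite exprn_gt0. Qed.
Let s4 : 0 < sigma ^+ 4. Proof. by rewrite exprn_gt0. Qed.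

(** The kernel at time [tau - th] is the integral over [c, +oo[ of the passage
    densities, whose time convolution is known. *)
Lemma potential0E a c : 0 < a -> 0 < c ->
  (\int[mu]_(th in `]0%R, tau[) (K th a * K (tau - th) c)%:E
   = (potential0 a c)%:E)%E.
Proof.
move=> a0 c0.
pose g (p : R * R) := K p.1 a * (p.2 / (sigma ^+ 2 * (tau - p.1)) * K (tau - p.1) p.2).
have mg : measurable_fun setT g.
  have m1 : measurable_fun [set: R * R] (fun p : R * R => tau - p.1).
    by apply: measurable_funB => //; exact: measurable_fst.
  apply: measurable_funM.
    by apply: measurable_gauss_kernel => //; exact: measurable_fst.
  apply: measurable_funM; last by apply: measurable_gauss_kernel => //; exact: measurable_snd.
  apply: measurable_funM; first exact: measurable_snd.
  by apply: measurable_funV; exact: measurable_funM.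
transitivity (\int[mu]_(th in `]0%R, tau[) \int[mu]_(v in `[c, +oo[) (g (th, v))%:E)%E.
  apply: eq_integral => th; rewrite inE/= in_itv/= => /andP[h0 h1].
  have t0 : 0 < tau - th by rewrite subr_gt0.
  rewrite EFinM -(gauss_kernel_passage t0 (ltW c0)) -ge0_integralZl//=.
  - apply/measurable_EFinP; apply: measurable_funTS; apply: measurable_funM.
      exact: measurable_funM.
    exact: measurable_gauss_kernel.
  - move=> v; rewrite in_itv/= andbT => cv; rewrite lee_fin; apply: mulr_ge0.
      by apply: divr_ge0; [exact: (le_trans (ltW c0))|exact/ltW/variance_gt0].
    exact/ltW/gauss_kernel_gt0.
  - by rewrite lee_fin; exact/ltW/gauss_kernel_gt0.
rewrite tonelli_in//; last first.
  move=> th v; rewrite /= !in_itv/= andbT => /andP[h0 h1] cv.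
  have t0 : 0 < tau - th by rewrite subr_gt0.
  apply: mulr_ge0; first exact/ltW/gauss_kernel_gt0.
  apply: mulr_ge0; last exact/ltW/gauss_kernel_gt0.
  by apply: divr_ge0; [exact: (le_trans (ltW c0))|exact/ltW/variance_gt0].
transitivity (\int[mu]_(v in `[c, +oo[) (K tau (a + v) / sigma ^+ 2)%:E)%E.
  apply: eq_integral => v; rewrite inE/= in_itv/= andbT => cv.
  by rewrite passage_convolution// (lt_le_trans c0).
have dF x : has_deriv (fun x => - potential0 a x) x (K tau (a + x) / sigma ^+ 2).
  apply: has_deriv_eq.
    apply: has_derivN; apply: has_derivM; last exact: has_deriv_cst.
    apply: has_deriv_comp; first exact: gauss_tail_deriv.
    by apply: has_derivD; [exact: has_deriv_cst|exact: has_deriv_id].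
  by rewrite /=; ring.
rewrite (@ge0_continuous_FTC2y _ _ (fun x => - potential0 a x) c 0).
- by rewrite EFinN oppeK add0e.
- by move=> x _; apply: divr_ge0; [exact/ltW/gauss_kernel_gt0|exact: ltW].
- apply: continuous_subspaceT => x; apply: cvgM; last exact: cvg_cst.
  apply: (@continuous_comp _ _ _ (fun x => a + x) (K tau)); last exact: ctn_K.
  by apply: cvgD; [exact: cvg_cst|exact: cvg_id].
- rewrite -[X in _ --> X](_ : - (0 / sigma ^+ 2) = 0); last by rewrite mul0r oppr0.
  apply: cvgN; apply: cvgM; last exact: cvg_cst.
  apply: (cvg_comp (fun x => a + x) E); [exact: cvg_addrl|exact: cvg_gauss_tail].
- by move=> x _; exact: has_deriv_derivable (dF x).
- by apply: cvg_at_right_filter; exact: has_deriv_continuous (dF c).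
- by move=> x _; exact: has_deriv_derive1 (dF x).
Qed.

(** [th * K th a] is the integral over [a, +oo[ of [w / sigma ^+ 2 * K th w],
    which reduces the second source to the first one. *)
Lemma potential1E a c : 0 < a -> 0 < c ->
  (\int[mu]_(th in `]0%R, tau[) (th * (K th a * K (tau - th) c))%:E
   = (potential1 a c)%:E)%E.
Proof.
move=> a0 c0.
pose g (p : R * R) := K (tau - p.1) c * (p.2 / sigma ^+ 2 * K p.1 p.2).
have mg : measurable_fun setT g.
  have m1 : measurable_fun [set: R * R] (fun p : R * R => tau - p.1).
    by apply: measurable_funB => //; exact: measurable_fst.
  apply: measurable_funM; first exact: measurable_gauss_kernel.
  apply: measurable_funM.
    by apply: measurable_funM => //; exact: measurable_snd.
  by apply: measurable_gauss_kernel; [exact: measurable_fst|exact: measurable_snd].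
transitivity (\int[mu]_(th in `]0%R, tau[) \int[mu]_(w in `[a, +oo[) (g (th, w))%:E)%E.
  apply: eq_integral => th; rewrite inE/= in_itv/= => /andP[h0 h1].
  have t0 : 0 < tau - th by rewrite subr_gt0.
  rewrite mulrA mulrC (EFinM _ (th * _)) (EFinM th) -(gauss_kernel_passage h0 (ltW a0)).
  rewrite -(ge0_integralZl (mu : {measure set (measurableTypeR R) -> \bar R}))//=; last 3 first.
  - apply/measurable_EFinP; apply: measurable_funTS; apply: measurable_funM.
      exact: measurable_funM.
    exact: measurable_gauss_kernel.
  - move=> w; rewrite in_itv/= andbT => aw; rewrite lee_fin; apply: mulr_ge0.
      by apply: divr_ge0; [exact: (le_trans (ltW a0))|exact/ltW/variance_gt0].
    exact/ltW/gauss_kernel_gt0.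
  - by rewrite lee_fin ltW.
  rewrite -(ge0_integralZl (mu : {measure set (measurableTypeR R) -> \bar R}))//=; last 3 first.
  - apply/measurable_EFinP; apply: measurable_funTS; apply: measurable_funM => //.
    apply: measurable_funM; first exact: measurable_funM.
    exact: measurable_gauss_kernel.
  - move=> w; rewrite in_itv/= andbT => aw; rewrite lee_fin; apply: mulr_ge0; first exact: ltW.
    apply: mulr_ge0; last exact/ltW/gauss_kernel_gt0.
    by apply: divr_ge0; [exact: (le_trans (ltW a0))|exact/ltW/variance_gt0].
  - by rewrite lee_fin; exact/ltW/gauss_kernel_gt0.
  apply: eq_integral => w _; rewrite -!EFinM /g /=; congr EFin; congr (_ * _).
  by field; rewrite !gt_eqF.
rewrite tonelli_in//; last first.
  move=> th w; rewrite /= !in_itv/= andbT => /andP[h0 h1] aw.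
  have t0 : 0 < tau - th by rewrite subr_gt0.
  apply: mulr_ge0; first exact/ltW/gauss_kernel_gt0.
  apply: mulr_ge0; last exact/ltW/gauss_kernel_gt0.
  by apply: divr_ge0; [exact: (le_trans (ltW a0))|exact: ltW].
transitivity (\int[mu]_(w in `[a, +oo[) (w * E (w + c) / sigma ^+ 4)%:E)%E.
  apply: eq_integral => w; rewrite inE/= in_itv/= andbT => aw.
  have w0 : 0 < w by exact: lt_le_trans aw.
  have -> : w * E (w + c) / sigma ^+ 4 = w / sigma ^+ 2 * potential0 w c.
    by rewrite /potential0; field; rewrite gt_eqF.
  rewrite EFinM -(potential0E w0 c0).
  transitivity (\int[mu]_(th in `]0%R, tau[)
      ((w / sigma ^+ 2)%:E * (K th w * K (tau - th) c)%:E))%E.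
    by apply: eq_integral => th _; rewrite -EFinM /g/=; congr EFin; ring.
  apply: ge0_integralZl.
  - exact: measurable_itv.
  - apply/measurable_EFinP; apply: measurable_funTS; apply: measurable_funM.
      exact: measurable_gauss_kernel.
    apply: measurable_gauss_kernel => //; exact: measurable_funB.
  - move=> th; rewrite /= in_itv/= => /andP[h0 h1].
    have t0 : 0 < tau - th by rewrite subr_gt0.
    by rewrite lee_fin; apply: mulr_ge0; exact/ltW/gauss_kernel_gt0.
  - by rewrite lee_fin; apply: divr_ge0; exact: ltW.
have dF x : has_deriv (fun x => - potential1 x c) x (x * E (x + c) / sigma ^+ 4).
  have dsh : has_deriv (fun x => x + c) x (1 + 0).
    by apply: has_derivD; [exact: has_deriv_id|exact: has_deriv_cst].
  apply: has_deriv_eq.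
    apply: has_derivN; apply: has_derivM; last exact: has_deriv_cst.
    apply: has_derivD.
      apply: has_derivM; first exact: has_deriv_id.
      by apply: has_deriv_comp; [exact: gauss_tail2_deriv|exact: dsh].
    by apply: has_deriv_comp; [exact: gauss_tail3_deriv|exact: dsh].
  by rewrite /=; ring.
rewrite (@ge0_continuous_FTC2y _ _ (fun x => - potential1 x c) a 0).
- by rewrite EFinN oppeK add0e.
- move=> x ax; apply: divr_ge0; last exact: ltW.
  by apply: mulr_ge0; [exact: (le_trans (ltW a0))|exact: gauss_tail_ge0].
- apply: continuous_subspaceT => x; apply: cvgM; last exact: cvg_cst.
  apply: cvgM; first exact: cvg_id.
  apply: (@continuous_comp _ _ _ (fun x => x + c) E).
    by apply: cvgD; [exact: cvg_id|exact: cvg_cst].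
  exact: has_deriv_continuous (gauss_tail_deriv _ tau0 _).
(* With u = x + c, the primitive is a combination of functions u ^+ i * K u
   and u ^+ i * E u with i <= 2. *)
- have c1 : (fun u => (1 / 2) * (m * (u ^+ 1 * K tau u)) - (1 / 2) * (u ^+ 2 * E u)
      - c * m * (u ^+ 0 * K tau u) + c * (u ^+ 1 * E u) + m / 2 * (u ^+ 0 * E u)) u
      @[u --> +oo] --> (0 : R).
    rewrite -[X in _ --> X](_ : (1 / 2) * (m * 0) - (1 / 2) * 0 - c * m * 0 + c * 0 + m / 2 * 0 = 0); last by ring.
    apply: cvgD; last by apply: cvgM; [exact: cvg_cst|exact: cvg_pow_gauss_tail].
    apply: cvgD; last by apply: cvgM; [exact: cvg_cst|exact: cvg_pow_gauss_tail].
    apply: cvgB; last by apply: cvgM; [exact: cvg_cst|exact: cvg_pow_gauss_kernel].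
    apply: cvgB; last by apply: cvgM; [exact: cvg_cst|exact: cvg_pow_gauss_tail].
    apply: cvgM; first exact: cvg_cst.
    by apply: cvgM; [exact: cvg_cst|exact: cvg_pow_gauss_kernel].
  rewrite -[X in _ --> X](_ : - (0 / sigma ^+ 4) = 0); last by rewrite mul0r oppr0.
  apply: cvgN; apply: cvgM; last exact: cvg_cst.
  have := cvg_comp (fun x => x + c) _ (cvg_addrr c) c1.
  apply: cvg_trans; apply: near_eq_cvg; near=> x.
  by rewrite /= /gauss_tail2 /gauss_tail3; field.
- by move=> x _; exact: has_deriv_derivable (dF x).
- by apply: cvg_at_right_filter; exact: has_deriv_continuous (dF a).
- by move=> x _; exact: has_deriv_derive1 (dF x).
Unshelve. all: by end_near. Qed.

End fixed_time.
End source_kernels.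

(** * Iterated real-valued integrals *)

Section Rintegral_fubini.
Context {R : realType}.
Local Notation mu := (@lebesgue_measure R).
Implicit Types (D : set R) (F : R * R -> R).

Lemma integrable_realD D (f g : R -> R) : measurable D ->
  mu.-integrable D (EFin \o f) -> mu.-integrable D (EFin \o g) ->
  mu.-integrable D (EFin \o (fun x => f x + g x)).
Proof.
move=> mD f_int g_int; have := @integrableD _ _ _ mu _ mD _ _ f_int g_int.
exact: eq_integrable.
Qed.

Lemma integrable_realZ D (k : R) (f : R -> R) : measurable D ->
  mu.-integrable D (EFin \o f) -> mu.-integrable D (EFin \o (fun x => k * f x)).
Proof.
move=> mD f_int; have := @integrableZl _ _ _ mu _ mD k _ f_int.
exact: eq_integrable.
Qed.

Lemma le_integrable_real D (f g : R -> R) : measurable D -> measurable_fun D f ->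
  (forall x, D x -> `|f x| <= g x) -> mu.-integrable D (EFin \o g) ->
  mu.-integrable D (EFin \o f).
Proof.
move=> mD mf fg; apply: le_integrable => //; first exact/measurable_EFinP.
by move=> x Dx; rewrite lee_fin (le_trans (fg _ Dx))// ler_norm.
Qed.

Lemma ge0_integrable_real D (f : R -> R) (l : R) : measurable D ->
  measurable_fun D f -> (forall x, D x -> 0 <= f x) ->
  (\int[mu]_(x in D) (f x)%:E = l%:E)%E ->
  mu.-integrable D (EFin \o f) /\ \int[mu]_(x in D) f x = l.
Proof.
move=> mD mf f0 fl; split; last by rewrite /Rintegral fl.
apply/integrableP; split; first exact/measurable_EFinP.
have -> : (\int[mu]_(x in D) `|(EFin \o f) x| = \int[mu]_(x in D) (f x)%:E)%E.
  by apply: eq_integral => x; rewrite inE => xD; rewrite /= ger0_norm// f0.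
by rewrite fl ltry.
Qed.

Let fubini_real F : (mu \x mu)%E.-integrable setT (EFin \o F) ->
  mu.-integrable setT (EFin \o (fun x => \int[mu]_y F (x, y))) /\
  (\int[mu]_x (\int[mu]_y F (x, y))%:E = \int[mu]_x \int[mu]_y (F (x, y))%:E)%E.
Proof.
move=> iF; have iG := integrable_fubini_F iF; rewrite /fubini_F in iG.
have mG := measurable_int _ iG.
have mfG : measurable_fun setT (EFin \o (fun x => \int[mu]_y F (x, y))).
  by apply/measurable_EFinP; apply: measurableT_comp mG; exact: fine_measurable.
have eqG : ae_eq mu setT (EFin \o (fun x => \int[mu]_y F (x, y)))
    (fun x => \int[mu]_y (EFin \o F) (x, y))%E.
  have := integrable_ae measurableT iG; apply: filterS => x + _ => /(_ I).
  by move=> /fineK.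
split; last by apply: ae_eq_integral.
apply/integrableP; split=> //.
have [_ lty] := integrableP _ _ _ iG.
apply: le_lt_trans lty; rewrite le_eqVlt; apply/orP; left; apply/eqP.
apply: ae_eq_integral => //.
- exact: measurableT_comp.
- exact: measurableT_comp.
- by move: eqG; apply: filterS => x h xT; exact: (congr1 abse (h xT)).
Qed.

(** A real-valued inner integral differs from the extended one on the null set
    where the latter is infinite. *)
Lemma Fubini_Rintegral D1 D2 F : measurable D1 -> measurable D2 ->
  measurable_fun setT F ->
  (\int[mu]_(y in D2) \int[mu]_(x in D1) `|F (x, y)|%:E < +oo)%E ->
  [/\ mu.-integrable D1 (EFin \o (fun x => \int[mu]_(y in D2) F (x, y))),
      mu.-integrable D2 (EFin \o (fun y => \int[mu]_(x in D1) F (x, y))) &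
      \int[mu]_(x in D1) \int[mu]_(y in D2) F (x, y)
      = \int[mu]_(y in D2) \int[mu]_(x in D1) F (x, y)].
Proof.
move=> m1 m2 mF lty.
pose h := F \_ (D1 `*` D2).
have mh : measurable_fun setT (EFin \o h).
  apply/measurable_EFinP; apply/(measurable_restrictT _ _).1.
    exact: measurableX.
  exact: measurable_funS mF.
have h1 x : D1 x -> (fun y => h (x, y)) = (fun y => F (x, y)) \_ D2.
  move=> xD; apply/funext => y; rewrite /h !patchE; congr (if _ then _ else _).
  by apply/idP/idP; rewrite !inE => //=; case.
have h1N x y : ~ D1 x -> h (x, y) = 0.
  by move=> xD; rewrite /h patchE memNset//=; case.
have h2 y : D2 y -> (fun x => h (x, y)) = (fun x => F (x, y)) \_ D1.
  move=> xD; apply/funext => x; rewrite /h !patchE; congr (if _ then _ else _).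
  by apply/idP/idP; rewrite !inE => //=; case.
have h2N x y : ~ D2 y -> h (x, y) = 0.
  by move=> xD; rewrite /h patchE memNset//=; case.
have ih : (mu \x mu)%E.-integrable setT (EFin \o h).
  apply: (@integrable21ltyP _ _ _ _ R lebesgue_measure lebesgue_measure _ mh).2.
  apply: le_lt_trans lty; rewrite [leRHS]integral_mkcond le_eqVlt; apply/orP; left; apply/eqP.
  apply: eq_integral => y _; rewrite patchE; case: ifPn => [|/negP]; rewrite inE => yD.
    rewrite [RHS]integral_mkcond; apply: eq_integral => x _.
    rewrite /= -[h (x, y)]/((fun x => h (x, y)) x) h2// !patchE.
    by case: ifPn => //; rewrite normr0.
  by rewrite integral0_eq// => x _; rewrite /= h2N// normr0.
have mhs : measurable_fun setT (EFin \o (fun p : R * R => h (p.2, p.1))).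
  by apply: (measurableT_comp mh); apply: measurable_fun_pair.
have hs : (mu \x mu)%E.-integrable setT (EFin \o (fun p : R * R => h (p.2, p.1))).
  apply: (@integrable12ltyP _ _ _ _ R lebesgue_measure lebesgue_measure _ mhs).2.
  exact: (@integrable21ltyP _ _ _ _ R lebesgue_measure lebesgue_measure _ mh).1 ih.
have [i1 e1] := fubini_real ih; have [i2 e2] := fubini_real hs.
have f1 : (fun x => \int[mu]_y h (x, y)) = (fun x => \int[mu]_(y in D2) F (x, y)) \_ D1.
  apply/funext => x; rewrite patchE; case: ifPn => [|/negP]; rewrite inE => xD.
    by rewrite [RHS]Rintegral_mkcond -h1.
  rewrite (_ : (fun y => h (x, y)) = cst 0) ?Rintegral_cst ?mul0r//.
  by apply/funext => y; exact: h1N.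
have f2 : (fun y => \int[mu]_x h (x, y)) = (fun y => \int[mu]_(x in D1) F (x, y)) \_ D2.
  apply/funext => y; rewrite patchE; case: ifPn => [|/negP]; rewrite inE => yD.
    by rewrite [RHS]Rintegral_mkcond -h2.
  rewrite (_ : (fun x => h (x, y)) = cst 0) ?Rintegral_cst ?mul0r//.
  by apply/funext => x; exact: h2N.
rewrite f1 -restrict_EFin in i1; rewrite /= f2 -restrict_EFin in i2.
split.
- exact/integrable_mkcond.
- exact/integrable_mkcond.
rewrite Rintegral_mkcond [RHS]Rintegral_mkcond -f1 -f2 /Rintegral.
congr fine; rewrite e1; apply/esym; rewrite e2.
by rewrite -(@Fubini _ _ _ _ R lebesgue_measure lebesgue_measure _ ih).
Qed.

End Rintegral_fubini.

(** * The solution as a superposition of potentials *)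

Section representation.
Context {R : realType}.
Local Notation leb := (@lebesgue_measure R).

Lemma Rintegral_setD1 (f : R -> R) (x : R) (D : set R) : measurable D ->
  measurable_fun setT f -> \int[leb]_(z in D `\ x) f z = \int[leb]_(z in D) f z.
Proof.
move=> mD mf; rewrite /Rintegral integral_setD1//; first exact: measurableD.
by apply/measurable_EFinP; exact: measurable_funTS.
Qed.

Lemma gauss_tail_le1 (sigma t u : R) : 0 < sigma -> 0 < t -> gauss_tail sigma t u <= 1.
Proof.
move=> s0 t0; rewrite -[u]opprK gauss_tailN gerBl; exact: gauss_tail_ge0.
Qed.

Lemma measurable_potentials d (T : measurableType d) (sigma tau : R) (f g : T -> R) :
  0 < sigma -> 0 < tau -> measurable_fun setT f -> measurable_fun setT g ->
  measurable_fun setT (fun x => potential0 sigma tau (f x) (g x)) /\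
  measurable_fun setT (fun x => potential1 sigma tau (f x) (g x)).
Proof.
move=> s0 tau0 mf mg; have mfg : measurable_fun setT (fun x => f x + g x).
  exact: measurable_funD.
have comp (h h' : R -> R) : (forall x, has_deriv h x (h' x)) ->
    measurable_fun setT (fun x => h (f x + g x)).
  move=> hd; apply: (measurableT_comp _ mfg); apply: continuous_measurable_fun => x.
  exact: has_deriv_continuous (hd x).
split; apply: measurable_funM => //.
  exact: comp (gauss_tail_deriv _ tau0).
apply: measurable_funD; last exact: comp (gauss_tail3_deriv s0 tau0).
by apply: measurable_funM => //; exact: comp (gauss_tail2_deriv s0 tau0).
Qed.

Variables (s sigma mu r tau b : R) (f0 f1 : R -> R).
Hypotheses (s_neq0 : s != 0) (s0 : 0 < sigma) (tau0 : 0 < tau).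
Hypotheses (mf0 : measurable_fun setT f0) (mf1 : measurable_fun setT f1).
Hypotheses (if0 : leb.-integrable (omega b) (EFin \o f0)).
Hypotheses (if1 : leb.-integrable (omega b) (EFin \o f1)).
Hypotheses (z0 : forall x, ~ omega b x -> f0 x = 0).
Hypotheses (z1 : forall x, ~ omega b x -> f1 x = 0).
Local Notation K := (gauss_kernel sigma).

(** The function [W] of the heat equation, divided by [s]. *)
Definition source_potential y : R := \int[leb]_(z in omega b)
  (potential0 sigma tau `|z| `|y - z| * f0 z
   + potential1 sigma tau `|z| `|y - z| * f1 z).

Let mo : measurable (omega b). Proof. exact: measurable_itv. Qed.

Let potential_int a c : 0 < a -> 0 < c ->
  [/\ leb.-integrable `]0, tau[ (EFin \o (fun th => K th a * K (tau - th) c)),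
      \int[leb]_(th in `]0, tau[) (K th a * K (tau - th) c) = potential0 sigma tau a c,
      leb.-integrable `]0, tau[ (EFin \o (fun th => th * (K th a * K (tau - th) c))) &
      \int[leb]_(th in `]0, tau[) (th * (K th a * K (tau - th) c)) = potential1 sigma tau a c].
Proof.
move=> a0 c0.
have mK : measurable_fun setT (fun th : R => K th a * K (tau - th) c).
  apply: measurable_funM; first exact: measurable_gauss_kernel.
  by apply: measurable_gauss_kernel => //; exact: measurable_funB.
have K0 th : `]0, tau[%classic th -> 0 <= K th a * K (tau - th) c.
  rewrite /= in_itv/= => /andP[h0 h1].
  by apply: mulr_ge0; apply/ltW/gauss_kernel_gt0; rewrite ?subr_gt0.
have [i0 e0] := ge0_integrable_real (measurable_itv _) (measurable_funTS mK) K0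
  (potential0E s0 tau0 a0 c0).
have mtK : measurable_fun setT (fun th : R => th * (K th a * K (tau - th) c)).
  exact: measurable_funM.
have tK0 th : `]0, tau[%classic th -> 0 <= th * (K th a * K (tau - th) c).
  move=> h; apply: mulr_ge0; last exact: K0.
  by move: h; rewrite /= in_itv/= => /andP[/ltW].
have [i1 e1] := ge0_integrable_real (measurable_itv _) (measurable_funTS mtK) tK0
  (potential1E s0 tau0 a0 c0).
by split.
Qed.

(** After exchanging the two integrations, the time integral is a known
    potential, except when [z] is 0 or [y]. *)
Lemma cauchy_solutionE y :
  cauchy_solution s sigma mu r f0 f1 y tau
  = expR (coef_c sigma mu * y + coef_d sigma mu r * tau) * s * source_potential y.
Proof.
set C := expR _ * s.
pose h th z := K th `|z| * K (tau - th) `|y - z|.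
pose F (p : R * R) := C * (h p.1 p.2 * f0 p.2 + p.1 * h p.1 p.2 * f1 p.2).
(* The formulas for the potentials need positive distances to 0 and to y. *)
pose D := (omega b `\ 0) `\ y.
have mD : measurable D by apply: measurableD => //; exact: measurableD.
have mh : measurable_fun setT (fun p : R * R => h p.1 p.2).
  have mfst := @measurable_fst _ _ (measurableTypeR R) (measurableTypeR R).
  have msnd := @measurable_snd _ _ (measurableTypeR R) (measurableTypeR R).
  apply: measurable_funM; apply: measurable_gauss_kernel => //.
  - exact: (measurableT_comp (@normr_measurable R setT) msnd).
  - exact: measurable_funB.
  - apply: (measurableT_comp (@normr_measurable R setT)); exact: measurable_funB.
have mF : measurable_fun setT F.
  have mfst := @measurable_fst _ _ (measurableTypeR R) (measurableTypeR R).
  have msnd := @measurable_snd _ _ (measurableTypeR R) (measurableTypeR R).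
  apply: measurable_funM => //; apply: measurable_funD.
    by apply: measurable_funM => //; exact: (measurableT_comp mf0 msnd).
  apply: measurable_funM; last exact: (measurableT_comp mf1 msnd).
  exact: measurable_funM.
have mFz th : measurable_fun setT (fun z : R => F (th, z)).
  by apply: (measurableT_comp mF); exact: measurable_fun_pair.
have mFt z : measurable_fun setT (fun th : R => F (th, z)).
  by apply: (measurableT_comp mF); exact: measurable_fun_pair.
have Dz z : D z -> [/\ omega b z, 0 < `|z| & 0 < `|y - z|].
  case=> -[bz /eqP z_neq0] /eqP zy; split=> //; rewrite normr_gt0//.
  by rewrite subr_eq0 eq_sym.
have h0 th z : 0 < th < tau -> 0 <= h th z.
  by move=> /andP[h0 h1]; apply: mulr_ge0; apply/ltW/gauss_kernel_gt0; rewrite ?subr_gt0.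
transitivity (\int[leb]_(th in `]0, tau[) \int[leb]_(z in D) F (th, z)).
  rewrite /cauchy_solution; apply: eq_Rintegral => th.
  rewrite inE/= in_itv/= => /andP[th0 th1].
  rewrite !Rintegral_setD1//; last exact: measurableD.
  rewrite [RHS]Rintegral_mkcond; apply: eq_Rintegral => z _.
  rewrite patchE; case: ifPn => [_|/negP]; last first.
    by rewrite inE => zb; rewrite z0// z1// mulr0 addr0 !mulr0.
  rewrite mulrA fundsol_alpha0// /F /h /=.
  rewrite !gauss_kernel_norm.
  have -> : s / (Num.sqrt (2 * pi * th) * sigma) * expR (- (z ^+ 2 / (2 * th * sigma ^+ 2)))
     = s * K th z.
    by rewrite /gauss_kernel; ring.
  by rewrite /C; ring.
have inner z : D z -> \int[leb]_(th in `]0, tau[) F (th, z)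
    = C * (potential0 sigma tau `|z| `|y - z| * f0 z
           + potential1 sigma tau `|z| `|y - z| * f1 z).
  move=> /Dz[zb a0 c0]; have [i0 e0 i1 e1] := potential_int a0 c0.
  have mt : measurable `]0, tau[%classic by exact: measurable_itv.
  have j0 : leb.-integrable `]0, tau[ (EFin \o (fun th => h th z * f0 z)).
    have := integrable_realZ (f0 z) mt i0.
    by apply: eq_integrable => // th _ /=; rewrite mulrC.
  have j1 : leb.-integrable `]0, tau[ (EFin \o (fun th => th * h th z * f1 z)).
    have := integrable_realZ (f1 z) mt i1.
    by apply: eq_integrable => // th _ /=; rewrite mulrC.
  have j01 := integrable_realD mt j0 j1.
  rewrite (@RintegralZl _ _ _ leb _ _ C mt j01) (@RintegralD _ _ _ leb _ _ _ mt j0 j1).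
  rewrite (@RintegralZr _ _ _ leb _ _ (f0 z) mt i0) (@RintegralZr _ _ _ leb _ _ (f1 z) mt i1).
  by rewrite -e0 -e1.
(* The time integral of the kernels is potential0, at most 1 / sigma ^+ 2. *)
have lty : (\int[leb]_(z in D) \int[leb]_(th in `]0%R, tau[) `|F (th, z)|%:E < +oo)%E.
  have if01 : leb.-integrable D (EFin \o (fun z => `|C| * (sigma ^+ 2)^-1 * (`|f0 z| + tau * `|f1 z|))).
    have Do : D `<=` omega b by move=> z /Dz[].
    apply: integrable_realZ => //; apply: integrable_realD => //.
      exact: (@integrableS _ _ _ leb _ _ _ mo mD Do (integrable_norm if0)).
    apply: integrable_realZ => //.
    exact: (@integrableS _ _ _ leb _ _ _ mo mD Do (integrable_norm if1)).
  have /integrableP[_] := if01; apply: le_lt_trans.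
  apply: ge0_le_integral => //.
  - by move=> z _; apply: integral_ge0 => th _; rewrite lee_fin.
  - apply: measurable_funTS.
    pose G := (fun p : R * R => `|F p|) \_ (`]0, tau[%classic `*` setT).
    have mG : measurable_fun setT (EFin \o G).
      apply/measurable_EFinP; apply/(measurable_restrictT _ _).1.
        by apply: measurableX => //; exact: measurable_itv.
      by apply: measurable_funTS; exact: measurableT_comp.
    have G0 x : (0 <= (EFin \o G) x)%E.
      by rewrite lee_fin /G patchE; case: ifPn.
    have := @measurable_fun_fubini_tonelli_G _ _ _ _ R lebesgue_measure _ mG G0.
    apply: eq_measurable_fun => z _; rewrite /fubini_G [RHS]integral_mkcond.
    apply: eq_integral => th _; rewrite /G /= !patchE.
    have -> : ((th, z) \in `]0, tau[%classic `*` setT) = (th \in `]0%R, tau[%classic).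
      by apply/idP/idP; rewrite !inE => //=; case.
    by case: ifPn.
  - by apply: measurableT_comp => //; case/integrableP: if01.
  move=> z /[dup] Dz' /Dz[zb a0 c0]; have [i0 e0 i1 e1] := potential_int a0 c0.
  apply: (@le_trans _ _ (\int[leb]_(th in `]0%R, tau[)
      (`|C| * (`|f0 z| + tau * `|f1 z|) * (K th `|z| * K (tau - th) `|y - z|))%:E)%E).
    apply: ge0_le_integral => //.
    - apply/measurable_EFinP; apply: measurable_funTS; exact: (measurableT_comp (@normr_measurable R setT) (mFt z)).
    - have := integrable_realZ (`|C| * (`|f0 z| + tau * `|f1 z|)) (measurable_itv _) i0.
      by case/integrableP.
    move=> th; rewrite /= in_itv/= => th01; have hh := h0 th z th01.
    have /andP[/ltW th0 /ltW th1] := th01.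
    rewrite lee_fin; change (`|C * (h th z * f0 z + th * h th z * f1 z)|
      <= `|C| * (`|f0 z| + tau * `|f1 z|) * h th z).
    move: (h th z) hh => X X0; rewrite normrM -[leRHS]mulrA ler_wpM2l//.
    rewrite (le_trans (ler_normD _ _))// !normrM (ger0_norm X0) (ger0_norm th0).
    rewrite mulrDl [X * _]mulrC lerD2l -!mulrA [X * _]mulrC ler_wpM2r// mulr_ge0//.
  under eq_integral do rewrite EFinM.
  rewrite integralZl//.
  rewrite (potential0E s0 tau0 a0 c0).
  have S0 : 0 <= `|f0 z| + tau * `|f1 z| by rewrite addr_ge0// mulr_ge0// ltW.
  have sV : 0 <= (sigma ^+ 2)^-1 by rewrite invr_ge0 sqr_ge0.
  rewrite -EFinM /= lee_fin (le_trans _ (ler_norm _))//.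
  rewrite [leRHS]mulrAC ler_wpM2l ?mulr_ge0//.
  by rewrite /potential0 -[leRHS]mul1r ler_wpM2r// gauss_tail_le1.
have [_ iG ->] := Fubini_Rintegral (measurable_itv `]0, tau[) mD mF lty.
pose P z := potential0 sigma tau `|z| `|y - z| * f0 z
            + potential1 sigma tau `|z| `|y - z| * f1 z.
have C0 : C != 0 by rewrite mulf_neq0// gt_eqF// expR_gt0.
have iP : leb.-integrable D (EFin \o P).
  have := integrable_realZ C^-1 mD iG; apply: eq_integrable => // z.
  by rewrite inE => /inner /= ->; rewrite mulKf.
transitivity (\int[leb]_(z in D) (C * P z)).
  by apply: eq_Rintegral => z; rewrite inE => /inner.
have mo0 : measurable (omega b `\ 0) by exact: measurableD.
have mn : measurable_fun setT (fun z : R => `|y - z|).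
  by apply: (measurableT_comp (@normr_measurable R setT)); exact: measurable_funB.
have [mP0 mP1] := measurable_potentials s0 tau0 (@normr_measurable R setT) mn.
have mP : measurable_fun setT P by apply: measurable_funD; exact: measurable_funM.
by rewrite RintegralZl// !Rintegral_setD1.
Qed.

End representation.

(** * Second derivatives of superpositions *)

Section kernel_pairing.
Context {R : realType}.
Local Notation leb := (@lebesgue_measure R).
Implicit Types (p q a b z c : R).

Lemma continuous_bounded_itv (f : R -> R) a b : continuous f ->
  exists M, forall x, a <= x <= b -> `|f x| <= M.
Proof.
move=> cf; have [ab|ba] := leP a b; last first.
  by exists 0 => x /andP[ax xb]; have := le_trans ax xb; rewrite leNgt ba.
have [|c _ cP] := @EVT_max R (fun x => `|f x|) a b ab.
  apply: continuous_subspaceT => x; apply: (continuous_comp (cf x)).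
  exact: norm_continuous.
by exists `|f c| => x xab; apply: cP; rewrite in_itv.
Qed.

Lemma Rintegral_FTC2 (f F : R -> R) a b : a <= b -> continuous f ->
  (forall x, has_deriv F x (f x)) ->
  \int[leb]_(x in `[a, b]) f x = F b - F a.
Proof.
rewrite le_eqVlt => /predU1P[->|ab] cf dF.
  by rewrite set_itv1 Rintegral_set1 subrr.
rewrite /Rintegral (@continuous_FTC2 _ f F)//.
- exact: continuous_subspaceT.
- split; first by move=> x _; exact: has_deriv_derivable (dF x).
    by apply: cvg_at_right_filter; exact: has_deriv_continuous (dF a).
  by apply: cvg_at_left_filter; exact: has_deriv_continuous (dF b).
- by move=> x _; exact: has_deriv_derive1 (dF x).
Qed.

Lemma continuous_integrable_itv (f : R -> R) a b : continuous f ->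
  leb.-integrable `[a, b] (EFin \o f).
Proof.
move=> cf; apply: continuous_compact_integrable; first exact: segment_compact.
exact: continuous_subspaceT.
Qed.

Variables (phi phi1 phi2 : R -> R) (p q : R).
Hypotheses (dphi : forall x, has_deriv phi x (phi1 x)).
Hypotheses (dphi1 : forall x, has_deriv phi1 x (phi2 x)).
Hypotheses (cphi2 : continuous phi2).
Hypotheses (pq : p < q).
Hypotheses (phip : phi p = 0) (phiq : phi q = 0).
Hypotheses (phi1p : phi1 p = 0) (phi1q : phi1 q = 0).

Let cphi : continuous phi.
Proof. by move=> x; exact: has_deriv_continuous (dphi x). Qed.

Section one_source.
Variables (w w1 w2 : R -> R).
Hypotheses (dw : forall c, has_deriv w c (w1 c)).
Hypotheses (dw1 : forall c, has_deriv w1 c (w2 c)).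
Hypotheses (cw2 : continuous w2).

Let cw : continuous w.
Proof. by move=> x; exact: has_deriv_continuous (dw x). Qed.

(** On either side of the source at [z], Green's expression
    [w * phi2 - w2 * phi] is an exact derivative. *)
Let right z y := w (y - z) * phi2 y - w2 (y - z) * phi y.
Let left z y := w (z - y) * phi2 y - w2 (z - y) * phi y.

Let ctn_right z : continuous (right z).
Proof.
have sh y : {for y, continuous (fun y => y - z)}.
  by apply: cvgB; [exact: cvg_id|exact: cvg_cst].
move=> y; apply: cvgB; apply: cvgM.
- by apply: (continuous_comp (sh y)); exact: cw.
- exact: cphi2.
- by apply: (continuous_comp (sh y)); exact: cw2.
- exact: cphi.
Qed.

Let ctn_left z : continuous (left z).
Proof.
have sh y : {for y, continuous (fun y => z - y)}.
  by apply: cvgB; [exact: cvg_cst|exact: cvg_id].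
move=> y; apply: cvgB; apply: cvgM.
- by apply: (continuous_comp (sh y)); exact: cw.
- exact: cphi2.
- by apply: (continuous_comp (sh y)); exact: cw2.
- exact: cphi.
Qed.

Let int_right z a b : a <= b -> \int[leb]_(y in `[a, b]) right z y
  = (w (b - z) * phi1 b - w1 (b - z) * phi b)
    - (w (a - z) * phi1 a - w1 (a - z) * phi a).
Proof.
move=> ab; 
apply: (@Rintegral_FTC2 (right z)
  (fun y => w (y - z) * phi1 y - w1 (y - z) * phi y) a b ab (@ctn_right z)) => y.
have sh : has_deriv (fun y => y - z) y (1 + 0).
  by apply: has_derivD; [exact: has_deriv_id|rewrite -oppr0; apply: has_derivN; exact: has_deriv_cst].
apply: has_deriv_eq.
  apply: has_derivD.
    by apply: has_derivM; [apply: has_deriv_comp; [exact: dw|exact: sh]|exact: dphi1].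
  apply: has_derivN.
  by apply: has_derivM; [apply: has_deriv_comp; [exact: dw1|exact: sh]|exact: dphi].
by rewrite /= /right; ring.
Qed.

Let int_left z a b : a <= b -> \int[leb]_(y in `[a, b]) left z y
  = (w (z - b) * phi1 b + w1 (z - b) * phi b)
    - (w (z - a) * phi1 a + w1 (z - a) * phi a).
Proof.
move=> ab; 
apply: (@Rintegral_FTC2 (left z)
  (fun y => w (z - y) * phi1 y + w1 (z - y) * phi y) a b ab (@ctn_left z)) => y.
have sh : has_deriv (fun y => z - y) y (0 - 1).
  by apply: has_derivD; [exact: has_deriv_cst|apply: has_derivN; exact: has_deriv_id].
apply: has_deriv_eq.
  apply: has_derivD.
    by apply: has_derivM; [apply: has_deriv_comp; [exact: dw|exact: sh]|exact: dphi1].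
  by apply: has_derivM; [apply: has_deriv_comp; [exact: dw1|exact: sh]|exact: dphi].
by rewrite /= /left; ring.
Qed.

(** The slope of [w |y - z|] jumps by [2 * w1 0] at [y = z], which adds a Dirac
    mass at [z] to the second derivative. *)
Lemma pairing_one_source z :
  \int[leb]_(y in `]p, q[) (w `|y - z| * phi2 y)
  = \int[leb]_(y in `]p, q[) (w2 `|y - z| * phi y) + 2 * w1 0 * (phi \_ `]p, q[) z.
Proof.
have ctn_abs (h : R -> R) : continuous h -> continuous (fun y => h `|y - z|).
  move=> ch y; apply: (@continuous_comp _ _ _ (fun y => `|y - z|) h); last exact: ch.
  apply: (@continuous_comp _ _ _ (fun y => y - z) (fun u => `|u|)).
    by apply: cvgB; [exact: cvg_id|exact: cvg_cst].
  exact: norm_continuous.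
have ioo (h : R -> R) : continuous h -> leb.-integrable `]p, q[ (EFin \o h).
  move=> ch; apply: (@integrableS _ _ _ leb _ _ _ _ _ _ (continuous_integrable_itv p q ch)) => //.
  exact: subset_itv_oo_cc.
have c1 : continuous (fun y => w `|y - z| * phi2 y).
  by move=> y; apply: cvgM; [exact: ctn_abs|exact: cphi2].
have c2 : continuous (fun y => w2 `|y - z| * phi y).
  by move=> y; apply: cvgM; [exact: ctn_abs|exact: cphi].
apply/eqP; rewrite addrC -subr_eq; apply/eqP.
rewrite -RintegralB//; [|exact: ioo|exact: ioo].
have c12 : continuous (fun y => w `|y - z| * phi2 y - w2 `|y - z| * phi y).
  by move=> y; apply: cvgB; [exact: c1|exact: c2].
have toc : \int[leb]_(y in `]p, q[) (w `|y - z| * phi2 y - w2 `|y - z| * phi y)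
         = \int[leb]_(y in `[p, q]) (w `|y - z| * phi2 y - w2 `|y - z| * phi y).
  rewrite Rintegral_itv_bndo_bndc; last exact: ioo.
  rewrite Rintegral_itv_obnd_cbnd//.
  apply: (@integrableS _ _ _ leb _ _ _ _ _ _ (continuous_integrable_itv p q c12)) => //.
  exact: subset_itv_oc_cc.
rewrite toc.
have rightE y : z <= y -> w `|y - z| * phi2 y - w2 `|y - z| * phi y = right z y.
  by move=> zy; rewrite ger0_norm// subr_ge0.
have leftE y : y <= z -> w `|y - z| * phi2 y - w2 `|y - z| * phi y = left z y.
  by move=> zy; rewrite distrC ger0_norm// subr_ge0.
rewrite patchE; have [zp|pz] := leP z p.
  rewrite memNset/= ?in_itv/= ?ltNge ?zp// mulr0.
  transitivity (\int[leb]_(y in `[p, q]) right z y).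
    apply: eq_Rintegral => y; rewrite inE/= in_itv/= => /andP[py _].
    by rewrite rightE// (le_trans zp).
  by rewrite int_right ?ltW// phip phiq phi1p phi1q; ring.
have [qz|zq] := leP q z.
  rewrite memNset/= ?in_itv/= ?ltNge ?qz ?andbF// mulr0.
  transitivity (\int[leb]_(y in `[p, q]) left z y).
    apply: eq_Rintegral => y; rewrite inE/= in_itv/= => /andP[_ yq].
    by rewrite leftE// (le_trans yq).
  by rewrite int_left ?ltW// phip phiq phi1p phi1q; ring.
rewrite mem_set/= ?in_itv/= ?pz//.
have -> : `[p, q]%classic = `[p, z]%classic `|` `]z, q]%classic.
  by rewrite -itv_bndbnd_setU// bnd_simp ltW.
rewrite Rintegral_setU//; last 2 first.
- rewrite -itv_bndbnd_setU ?bnd_simp ?ltW//; exact: continuous_integrable_itv.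
- apply/disj_set2P; rewrite -subset0 => y [] /=; rewrite !in_itv/= => /andP[_ yz] /andP[].
  by rewrite ltNge yz.
rewrite Rintegral_itv_obnd_cbnd; last first.
  apply: (@integrableS _ _ _ leb _ _ _ _ _ _ (continuous_integrable_itv z q c12)) => //.
  exact: subset_itv_oc_cc.
transitivity (\int[leb]_(y in `[p, z]) left z y + \int[leb]_(y in `[z, q]) right z y).
  congr (_ + _); apply: eq_Rintegral => y; rewrite inE/= in_itv/= => /andP[? ?].
    by rewrite leftE.
  by rewrite rightE.
rewrite int_left ?ltW// int_right ?ltW// phip phiq phi1p phi1q subrr; ring.
Qed.

End one_source.
End kernel_pairing.

Section superposition.
Context {R : realType}.
Local Notation leb := (@lebesgue_measure R).
Variable b : R.
Local Notation om := (omega b).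

Let mo : measurable om. Proof. exact: measurable_itv. Qed.

(** The domination of [k] by a function of the source [z] alone is what makes
    the exchange of integrals legitimate. *)
Lemma superposition_pairing (k : R -> R -> R) (B psi : R -> R) p q M :
  measurable_fun setT (fun x : R * R => k x.2 x.1) ->
  measurable_fun setT psi ->
  (forall y, p < y < q -> `|psi y| <= M) ->
  (forall z y, om z -> p < y < q -> `|k z y| <= B z) ->
  leb.-integrable om (EFin \o B) ->
  [/\ leb.-integrable om (EFin \o (fun z => \int[leb]_(y in `]p, q[) (k z y * psi y))),
      leb.-integrable `]p, q[ (EFin \o (fun y => (\int[leb]_(z in om) k z y) * psi y)) &
      \int[leb]_(y in `]p, q[) ((\int[leb]_(z in om) k z y) * psi y)
      = \int[leb]_(z in om) \int[leb]_(y in `]p, q[) (k z y * psi y)].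
Proof.
move=> mk mpsi psiM kB iB.
have mI : measurable `]p, q[%classic by exact: measurable_itv.
have mkz y : measurable_fun setT (k^~ y).
  have my : measurable_fun setT (fun z : R => (y, z)) by exact: measurable_fun_pair.
  exact: (measurableT_comp mk my).
have mky z : measurable_fun setT (k z).
  have mz : measurable_fun setT (fun y : R => (y, z)) by exact: measurable_fun_pair.
  exact: (measurableT_comp mk mz).
pose F (x : R * R) := k x.2 x.1 * psi x.1.
have mF : measurable_fun setT F.
  apply: measurable_funM => //; apply: (measurableT_comp mpsi).
  exact: measurable_fst.
have ik y : p < y < q -> leb.-integrable om (EFin \o k^~ y).
  move=> ypq; apply: (le_integrable_real mo (measurable_funTS (mkz y)) _ iB).
  by move=> z zo; exact: kB.
have lty : (\int[leb]_(z in om) \int[leb]_(y in `]p, q[) `|F (y, z)|%:E < +oo)%E.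
  have iBM := integrable_realZ (`|M| * `|q - p|) mo (integrable_norm iB).
  have /integrableP[_] := iBM; apply: le_lt_trans.
  apply: ge0_le_integral => //.
  - by move=> z _; apply: integral_ge0 => y _; rewrite lee_fin.
  - apply: measurable_funTS.
    pose G := (fun x : R * R => `|F x|) \_ (`]p, q[%classic `*` setT).
    have mG : measurable_fun setT (EFin \o G).
      apply/measurable_EFinP; apply/(measurable_restrictT _ _).1.
        by apply: measurableX => //; exact: measurable_itv.
      by apply: measurable_funTS; exact: measurableT_comp.
    have G0 x : (0 <= (EFin \o G) x)%E.
      by rewrite lee_fin /G patchE; case: ifPn.
    have := @measurable_fun_fubini_tonelli_G _ _ _ _ R lebesgue_measure _ mG G0.
    apply: eq_measurable_fun => z _; rewrite /fubini_G [RHS]integral_mkcond.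
    apply: eq_integral => y _; rewrite /G /= !patchE.
    have -> : ((y, z) \in `]p, q[%classic `*` setT) = (y \in `]p, q[%classic).
      by apply/idP/idP; rewrite !inE => //=; case.
    by case: ifPn.
  - by apply: measurableT_comp => //; case/integrableP: iBM.
  move=> z zo.
  have mFz : measurable_fun setT (fun y => F (y, z)).
    exact: (measurable_funM (mky z) mpsi).
  apply: (@le_trans _ _ (\int[leb]_(y in `]p, q[) (`|M| * `|B z|)%:E)%E).
    apply: ge0_le_integral => //.
    - apply/measurable_EFinP; apply: measurable_funTS.
      exact: (measurableT_comp (@normr_measurable R setT) mFz).
    move=> y; rewrite /= in_itv/= => ypq; rewrite lee_fin /F /= normrM mulrC.
    by rewrite ler_pM// (le_trans _ (ler_norm _))//; [exact: psiM|exact: kB].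
  rewrite integral_cst// /= lebesgue_measure_itv/= lte_fin; case: ifPn => pq.
    rewrite -EFinM /= lee_fin (le_trans _ (ler_norm _))//.
    by rewrite [leLHS]mulrAC ler_wpM2r// ler_wpM2l// ler_norm.
  by rewrite mule0 lee_fin.
have [i1 i2 e] := Fubini_Rintegral mI mo mF lty.
have inner y : p < y < q ->
    \int[leb]_(z in om) F (y, z) = (\int[leb]_(z in om) k z y) * psi y.
  by move=> ypq; exact: (@RintegralZr _ _ _ leb _ _ (psi y) mo (ik y ypq)).
split; [exact: i2| |].
  have := i1; apply: eq_integrable => // y; rewrite inE/= in_itv/= => /inner.
  by move=> /= ->.
by rewrite -e; apply: eq_Rintegral => y; rewrite inE/= in_itv/= => /inner ->.
Qed.

Variables (w w1 w2 : R -> R -> R) (B : R -> R).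
Hypotheses (dw : forall z c, has_deriv (w z) c (w1 z c)).
Hypotheses (dw1 : forall z c, has_deriv (w1 z) c (w2 z c)).
Hypotheses (cw2 : forall z, continuous (w2 z)).
Hypotheses (mw : measurable_fun setT (fun x : R * R => w x.2 `|x.1 - x.2|)).
Hypotheses (mw2 : measurable_fun setT (fun x : R * R => w2 x.2 `|x.1 - x.2|)).
Hypotheses (mw1 : measurable_fun setT (fun z : R => w1 z 0)).
Hypotheses (wB : forall z y, om z -> om y -> `|w z `|y - z| | <= B z).
Hypotheses (w2B : forall z y, om z -> om y -> `|w2 z `|y - z| | <= B z).
Hypotheses (w1B : forall z, om z -> `|w1 z 0| <= B z).
Hypotheses (iB : leb.-integrable om (EFin \o B)).

(** The smooth part of the second derivative, and the Dirac masses created by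
    the corners of [w z |y - z|] at [y = z]. *)
Definition superposition2 y := (\int[leb]_(z in om) w2 z `|y - z|) + 2 * w1 y 0.

Lemma superposition_integrable :
  leb.-integrable om (EFin \o (fun y => \int[leb]_(z in om) w z `|y - z|)) /\
  leb.-integrable om (EFin \o superposition2).
Proof.
have h (k : R -> R -> R) : measurable_fun setT (fun x : R * R => k x.2 `|x.1 - x.2|) ->
   (forall z y, om z -> om y -> `|k z `|y - z| | <= B z) ->
   leb.-integrable om (EFin \o (fun y => \int[leb]_(z in om) k z `|y - z|)).
  move=> mk kB.
  have c1 (y : R) : - b < y < b -> `|cst 1 y| <= (1 : R) by move=> _; rewrite normr1.
  have kB' z y : om z -> - b < y < b -> `|k z `|y - z| | <= B z.
    by move=> zo yo; apply: kB => //; rewrite /omega/= in_itv.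
  have [_ + _] := superposition_pairing mk (measurable_cst _) c1 kB' iB.
  by apply: eq_integrable => // y _ /=; rewrite mulr1.
split; first exact: h.
apply: integrable_realD => //; first exact: h.
apply: integrable_realZ => //; apply: (le_integrable_real mo _ _ iB) => //.
exact: measurable_funTS.
Qed.

Lemma superposition_weak_derivative (phi phi1 phi2 : R -> R) p q :
  (forall x, has_deriv phi x (phi1 x)) -> (forall x, has_deriv phi1 x (phi2 x)) ->
  continuous phi2 -> - b <= p -> p < q -> q <= b ->
  phi p = 0 -> phi q = 0 -> phi1 p = 0 -> phi1 q = 0 ->
  \int[leb]_(y in `]p, q[) ((\int[leb]_(z in om) w z `|y - z|) * phi2 y)
  = \int[leb]_(y in `]p, q[) (superposition2 y * phi y).
Proof.
move=> dphi dphi1 cphi2 bp pq qb phip phiq phi1p phi1q.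
have cphi : continuous phi by move=> x; exact: has_deriv_continuous (dphi x).
have Ipq y : p < y < q -> om y.
  move=> /andP[py yq]; rewrite /omega/= in_itv/=.
  by rewrite (le_lt_trans bp py) (lt_le_trans yq qb).
have [M MP] := continuous_bounded_itv p q cphi.
have [M2 M2P] := continuous_bounded_itv p q cphi2.
have MP' y : p < y < q -> `|phi y| <= M by move=> /andP[/ltW ? /ltW ?]; exact/MP/andP.
have M2P' y : p < y < q -> `|phi2 y| <= M2 by move=> /andP[/ltW ? /ltW ?]; exact/M2P/andP.
have kwB z y : om z -> p < y < q -> `|w z `|y - z| | <= B z.
  by move=> zo /Ipq; exact: wB.
have kw2B z y : om z -> p < y < q -> `|w2 z `|y - z| | <= B z.
  by move=> zo /Ipq; exact: w2B.
have mphi := continuous_measurable_fun cphi.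
have mphi2 := continuous_measurable_fun cphi2.
have [_ _ ->] := @superposition_pairing (fun z y => w z `|y - z|) B phi2 p q M2
  mw mphi2 M2P' kwB iB.
have [i2 j2 e2] := @superposition_pairing (fun z y => w2 z `|y - z|) B phi p q M
  mw2 mphi MP' kw2B iB.
under eq_Rintegral => z _ do
  rewrite (pairing_one_source dphi dphi1 cphi2 pq phip phiq phi1p phi1q (dw z) (dw1 z) (@cw2 z)).
have mI : measurable `]p, q[%classic by exact: measurable_itv.
have Io : `]p, q[%classic `<=` om by move=> y; rewrite /= in_itv/= => /Ipq.
have iw1 : leb.-integrable om (EFin \o (fun z => 2 * w1 z 0)).
  apply: integrable_realZ => //; apply: (le_integrable_real mo _ _ iB) => //.
  exact: measurable_funTS.
have mrest : measurable_fun setT (phi \_ `]p, q[).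
  by apply/(measurable_restrictT _ _).1 => //; exact: measurable_funTS.
have id : leb.-integrable om (EFin \o (fun z => 2 * w1 z 0 * (phi \_ `]p, q[) z)).
  have iM := integrable_realZ `|M| mo (integrable_norm iw1).
  apply: (le_integrable_real mo _ _ iM).
    apply: measurable_funTS; apply: measurable_funM => //; exact: measurable_funM.
  move=> z zo; rewrite normrM mulrC ler_wpM2r// patchE; case: ifPn => [|_].
    by rewrite inE/= in_itv/= => /MP' /le_trans; apply; exact: ler_norm.
  by rewrite normr0.
rewrite RintegralD// -e2.
have -> : \int[leb]_(z in om) (2 * w1 z 0 * (phi \_ `]p, q[) z)
        = \int[leb]_(z in `]p, q[) (2 * w1 z 0 * phi z).
  rewrite -{2}(setIidr Io) Rintegral_mkcondr; apply: eq_Rintegral => z _.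
  by rewrite !patchE; case: ifPn; rewrite ?mulr0.
rewrite -RintegralD//.
  by apply: eq_Rintegral => y _; rewrite /superposition2 [RHS]mulrDl.
apply: (@eq_integrable _ _ _ leb _ mI (EFin \o (fun z => 2 * w1 z 0 * (phi \_ `]p, q[) z))).
  by move=> z zI /=; rewrite patchE zI.
exact: (@integrableS _ _ _ leb _ _ _ mo mI Io id).
Qed.

End superposition.

(** * The second derivative of the potential *)

Section potential_derivatives.
Context {R : realType}.
Local Notation leb := (@lebesgue_measure R).
Variables (sigma tau b : R).
Hypotheses (s0 : 0 < sigma) (tau0 : 0 < tau) (b0 : 0 < b).
Local Notation K := (gauss_kernel sigma tau).
Local Notation E := (gauss_tail sigma tau).
Local Notation m := (sigma ^+ 2 * tau).
Local Notation om := (omega b).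
Variables (f0 f1 : R -> R).
Hypotheses (mf0 : measurable_fun setT f0) (mf1 : measurable_fun setT f1).
Hypotheses (if0 : leb.-integrable (omega b) (EFin \o f0)).
Hypotheses (if1 : leb.-integrable (omega b) (EFin \o f1)).

Let m0 : 0 < m. Proof. exact: variance_gt0. Qed.
Let s2 : 0 < (sigma ^+ 2)^-1. Proof. by rewrite invr_gt0 exprn_gt0. Qed.
Let s4 : 0 < (sigma ^+ 4)^-1. Proof. by rewrite invr_gt0 exprn_gt0. Qed.
Let mo : measurable om. Proof. exact: measurable_itv. Qed.

(** The potential at distance [c] of the source at [z], followed by its
    derivatives in [c]. *)
Definition source (z c : R) : R := potential0 sigma tau `|z| c * f0 z
  + potential1 sigma tau `|z| c * f1 z.
Definition source1 (z c : R) : R := - (K (`|z| + c) / sigma ^+ 2) * f0 z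
  - (m * K (`|z| + c) - c * E (`|z| + c)) / sigma ^+ 4 * f1 z.
Definition source2 (z c : R) : R := (`|z| + c) / m * K (`|z| + c) / sigma ^+ 2 * f0 z
  + (`|z| * K (`|z| + c) + E (`|z| + c)) / sigma ^+ 4 * f1 z.

Let shift (z c : R) : has_deriv (fun c => `|z| + c) c (0 + 1).
Proof. by apply: has_derivD; [exact: has_deriv_cst|exact: has_deriv_id]. Qed.

Lemma source_deriv z c : has_deriv (source z) c (source1 z c).
Proof.
apply: has_deriv_eq.
  apply: has_derivD.
    apply: has_derivM; last exact: has_deriv_cst.
    apply: has_derivM; last exact: has_deriv_cst.
    by apply: has_deriv_comp; [exact: gauss_tail_deriv|exact: shift].
  apply: has_derivM; last exact: has_deriv_cst.
  apply: has_derivM; last exact: has_deriv_cst.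
  apply: has_derivD.
    apply: has_derivM; first exact: has_deriv_cst.
    by apply: has_deriv_comp; [exact: gauss_tail2_deriv|exact: shift].
  by apply: has_deriv_comp; [exact: gauss_tail3_deriv|exact: shift].
by rewrite /= /source1 /gauss_tail2; ring.
Qed.

Lemma source1_deriv z c : has_deriv (source1 z) c (source2 z c).
Proof.
have dK : has_deriv (fun c => K (`|z| + c)) c (- ((`|z| + c) / m) * K (`|z| + c) * (0 + 1)).
  by apply: has_deriv_comp; [exact: gauss_kernel_deriv|exact: shift].
have dE : has_deriv (fun c => E (`|z| + c)) c (- K (`|z| + c) * (0 + 1)).
  by apply: has_deriv_comp; [exact: gauss_tail_deriv|exact: shift].
apply: has_deriv_eq.
  apply: has_derivD.
    apply: has_derivM; last exact: has_deriv_cst.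
    by apply: has_derivN; apply: has_derivM; [exact: dK|exact: has_deriv_cst].
  apply: has_derivN; apply: has_derivM; last exact: has_deriv_cst.
  apply: has_derivM; last exact: has_deriv_cst.
  apply: has_derivD; first by apply: has_derivM; [exact: has_deriv_cst|exact: dK].
  by apply: has_derivN; apply: has_derivM; [exact: has_deriv_id|exact: dE].
by rewrite /= /source2; field; rewrite !gt_eqF.
Qed.

Let cK : continuous K.
Proof. by move=> x; exact: has_deriv_continuous (gauss_kernel_deriv s0 tau0 x). Qed.
Let cE : continuous E.
Proof. by move=> x; exact: has_deriv_continuous (gauss_tail_deriv sigma tau0 x). Qed.

Lemma source2_continuous z : continuous (source2 z).
Proof.
have sh c : {for c, continuous (fun c => `|z| + c)}.
  by apply: cvgD; [exact: cvg_cst|exact: cvg_id].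
have cKz c : {for c, continuous (fun c => K (`|z| + c))}.
  by apply: (continuous_comp (sh c)); exact: cK.
have cEz c : {for c, continuous (fun c => E (`|z| + c))}.
  by apply: (continuous_comp (sh c)); exact: cE.
move=> c; apply: cvgD; apply: cvgM; [|exact: cvg_cst| |exact: cvg_cst].
  apply: cvgM; last exact: cvg_cst.
  by apply: cvgM; [apply: cvgM; [exact: sh|exact: cvg_cst]|exact: cKz].
apply: cvgM; last exact: cvg_cst.
by apply: cvgD; [apply: cvgM; [exact: cvg_cst|exact: cKz]|exact: cEz].
Qed.

Let mfst := @measurable_fst _ _ (measurableTypeR R) (measurableTypeR R).
Let msnd := @measurable_snd _ _ (measurableTypeR R) (measurableTypeR R).
Let mabs := @normr_measurable R setT.
Let mdist : measurable_fun setT (fun x : R * R => `|x.1 - x.2|).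
Proof. by apply: (measurableT_comp mabs); exact: measurable_funB. Qed.
Let mz : measurable_fun setT (fun x : R * R => `|x.2|).
Proof. exact: (measurableT_comp mabs msnd). Qed.

Lemma measurable_source : measurable_fun setT (fun x : R * R => source x.2 `|x.1 - x.2|).
Proof.
have [mP0 mP1] := measurable_potentials s0 tau0 mz mdist.
apply: measurable_funD; apply: measurable_funM => //.
  exact: (measurableT_comp mf0 msnd).
exact: (measurableT_comp mf1 msnd).
Qed.

Lemma measurable_source2 : measurable_fun setT (fun x : R * R => source2 x.2 `|x.1 - x.2|).
Proof.
have mu : measurable_fun setT (fun x : R * R => `|x.2| + `|x.1 - x.2|).
  exact: measurable_funD.
have mK : measurable_fun setT (fun x : R * R => K (`|x.2| + `|x.1 - x.2|)).
  exact: (measurableT_comp (continuous_measurable_fun cK) mu).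
have mE : measurable_fun setT (fun x : R * R => E (`|x.2| + `|x.1 - x.2|)).
  exact: (measurableT_comp (continuous_measurable_fun cE) mu).
apply: measurable_funD; apply: measurable_funM.
- by apply: measurable_funM => //; apply: measurable_funM => //; exact: measurable_funM.
- exact: (measurableT_comp mf0 msnd).
- by apply: measurable_funM => //; apply: measurable_funD => //; exact: measurable_funM.
- exact: (measurableT_comp mf1 msnd).
Qed.

Lemma source1_at0 z : source1 z 0 = - (K z / sigma ^+ 2) * (f0 z + tau * f1 z).
Proof.
rewrite /source1 addr0 gauss_kernel_norm.
by field; rewrite gt_eqF// exprn_gt0.
Qed.

Lemma measurable_source1 : measurable_fun setT (fun z : R => source1 z 0).
Proof.
rewrite (_ : (fun _ => _) = fun z => - (K z / sigma ^+ 2) * (f0 z + tau * f1 z)).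
  apply: measurable_funM; last by apply: measurable_funD => //; exact: measurable_funM.
  apply: measurableT_comp => //; apply: measurable_funM => //.
  exact: continuous_measurable_fun.
by apply/funext => z; exact: source1_at0.
Qed.

Lemma source_bound : exists B : R -> R,
  [/\ leb.-integrable om (EFin \o B),
      forall z y, om z -> om y -> `|source z `|y - z| | <= B z,
      forall z y, om z -> om y -> `|source2 z `|y - z| | <= B z &
      forall z, om z -> `|source1 z 0| <= B z].
Proof.
have [M1 M1P] := continuous_bounded_itv 0 (3 * b) cK.
have [M2 M2P] := continuous_bounded_itv 0 (3 * b) cE.
have cE2 : continuous (gauss_tail2 sigma tau).
  by move=> x; exact: has_deriv_continuous (gauss_tail2_deriv s0 tau0 x).
have cE3 : continuous (gauss_tail3 sigma tau).
  by move=> x; exact: has_deriv_continuous (gauss_tail3_deriv s0 tau0 x).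
have [M3 M3P] := continuous_bounded_itv 0 (3 * b) cE2.
have [M4 M4P] := continuous_bounded_itv 0 (3 * b) cE3.
have omE z : om z -> `|z| < b by rewrite /omega/= in_itv/= ltr_norml.
have uP z y : om z -> om y -> 0 <= `|z| + `|y - z| <= 3 * b.
  move=> /omE zb /omE yb; rewrite addr_ge0//=.
  by have := ler_normB y z; lra.
have zP z : om z -> 0 <= `|z| <= 3 * b by move=> /omE zb; have := normr_ge0 z => ->/=; have := normr_ge0 z; lra.
have M0 (h : R -> R) M : (forall x, 0 <= x <= 3 * b -> `|h x| <= M) -> 0 <= M.
  move=> hM; apply: (le_trans (normr_ge0 (h 0))); apply: hM.
  by rewrite lexx mulr_ge0// ltW.
have M10 := M0 _ _ M1P; have M20 := M0 _ _ M2P; have M30 := M0 _ _ M3P; have M40 := M0 _ _ M4P.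
have bnd c0 c1 d0 d1 z : `|c0| <= d0 -> `|c1| <= d1 ->
    `|c0 * f0 z + c1 * f1 z| <= d0 * `|f0 z| + d1 * `|f1 z|.
  move=> h0 h1; rewrite (le_trans (ler_normD _ _))// !normrM.
  by rewrite lerD// ler_wpM2r.
pose A0 := M2 / sigma ^+ 2; pose A1 := (b * M3 + M4) / sigma ^+ 4.
pose C0 := 3 * b / m * M1 / sigma ^+ 2; pose C1 := (b * M1 + M2) / sigma ^+ 4.
pose D0 := M1 / sigma ^+ 2 * 1; pose D1 := M1 / sigma ^+ 2 * tau.
have b0' := ltW b0; have s2' := ltW s2; have s4' := ltW s4; have tau0' := ltW tau0.
have im : 0 <= m^-1 by rewrite invr_ge0 ltW.
have A00 : 0 <= A0 by apply: mulr_ge0.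
have A10 : 0 <= A1 by apply: mulr_ge0 => //; apply: addr_ge0 => //; apply: mulr_ge0.
have C00 : 0 <= C0.
  by apply: mulr_ge0 => //; apply: mulr_ge0 => //; apply: mulr_ge0 => //; apply: mulr_ge0.
have C10 : 0 <= C1 by apply: mulr_ge0 => //; apply: addr_ge0 => //; apply: mulr_ge0.
have D00 : 0 <= D0 by apply: mulr_ge0 => //; apply: mulr_ge0.
have D10 : 0 <= D1 by apply: mulr_ge0 => //; apply: mulr_ge0.
exists (fun z => (A0 + C0 + D0) * `|f0 z| + (A1 + C1 + D1) * `|f1 z|); split.
- by apply: integrable_realD => //; apply: integrable_realZ => //; exact: integrable_norm.
- move=> z y zo yo; have u3 := uP _ _ zo yo; have zb := omE _ zo.
  have h0 : `|potential0 sigma tau `|z| `|y - z| | <= A0.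
    by rewrite normrM (gtr0_norm s2) ler_pM2r//; exact: M2P.
  have h1 : `|potential1 sigma tau `|z| `|y - z| | <= A1.
    rewrite normrM (gtr0_norm s4) ler_pM2r// (le_trans (ler_normD _ _))// lerD//.
      by rewrite normrM normr_id ler_pM// ?(ltW zb)//; exact: M3P.
    exact: M4P.
  rewrite (le_trans (bnd _ _ _ _ z h0 h1))// lerD// ler_wpM2r//.
    by rewrite -addrA lerDl addr_ge0.
  by rewrite -addrA lerDl addr_ge0.
- move=> z y zo yo; have u3 := uP _ _ zo yo; have zb := omE _ zo.
  have h0 : `|(`|z| + `|y - z|) / m * K (`|z| + `|y - z|) / sigma ^+ 2| <= C0.
    rewrite normrM (gtr0_norm s2) ler_pM2r// normrM ler_pM//; last exact: M1P.
    have im' : 0 < m^-1 by rewrite invr_gt0.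
    rewrite normrM (gtr0_norm im') ler_pM2r//.
    by case/andP : u3 => u0 u3; rewrite ger0_norm.
  have h1 : `|(`|z| * K (`|z| + `|y - z|) + E (`|z| + `|y - z|)) / sigma ^+ 4| <= C1.
    rewrite normrM (gtr0_norm s4) ler_pM2r// (le_trans (ler_normD _ _))// lerD//.
      by rewrite normrM normr_id ler_pM// ?(ltW zb)//; exact: M1P.
    exact: M2P.
  rewrite (le_trans (bnd _ _ _ _ z h0 h1))// lerD// ler_wpM2r//.
    by rewrite addrAC lerDr addr_ge0.
  by rewrite addrAC lerDr addr_ge0.
- move=> z zo; rewrite source1_at0 mulrDr mulrA.
  have h0 : `|- (K z / sigma ^+ 2)| <= D0.
    rewrite normrN normrM (gtr0_norm s2) /D0 mulr1 ler_pM2r//.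
    by rewrite -gauss_kernel_norm; apply: M1P; exact: zP.
  have h1 : `|- (K z / sigma ^+ 2) * tau| <= D1.
    by rewrite normrM (gtr0_norm tau0) ler_pM2r// (le_trans h0)// /D0 mulr1.
  rewrite (le_trans (bnd _ _ _ _ z h0 h1))// lerD// ler_wpM2r//.
    by rewrite lerDr addr_ge0.
  by rewrite lerDr addr_ge0.
Qed.

Definition source_potential2 y : R := superposition2 b source1 source2 y.

Lemma source_potential_integrable :
  leb.-integrable om (EFin \o source_potential sigma tau b f0 f1) /\
  leb.-integrable om (EFin \o source_potential2).
Proof.
have [B [iB wB w2B w1B]] := source_bound.
exact: (superposition_integrable measurable_source measurable_source2
  measurable_source1 wB w2B w1B iB).
Qed.

Lemma source_potential_weak_derivative (phi phi1 phi2 : R -> R) p q :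
  (forall x, has_deriv phi x (phi1 x)) -> (forall x, has_deriv phi1 x (phi2 x)) ->
  continuous phi2 -> - b <= p -> p < q -> q <= b ->
  phi p = 0 -> phi q = 0 -> phi1 p = 0 -> phi1 q = 0 ->
  \int[leb]_(y in `]p, q[) (source_potential sigma tau b f0 f1 y * phi2 y)
  = \int[leb]_(y in `]p, q[) (source_potential2 y * phi y).
Proof.
have [B [iB wB w2B w1B]] := source_bound.
exact: (superposition_weak_derivative source_deriv source1_deriv source2_continuous
  measurable_source measurable_source2 measurable_source1 wB w2B w1B iB).
Qed.

End potential_derivatives.

(** * The estimate at one time *)

#[local] Instance ae_filter_lebesgue (R : realType) :
  Filter (almost_everywhere (@lebesgue_measure R)).
Proof. exact: (@ae_filter_ringOfSetsType _ _ _ (@lebesgue_measure R)). Qed.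

Section ae_bounds.
Context {R : realType}.
Local Notation leb := (@lebesgue_measure R).
Variable b : R.
Hypothesis b0 : 0 < b.
Local Notation om := (omega b).

Let mo : measurable om. Proof. exact: measurable_itv. Qed.

Definition ae_bounded (f : R -> R) (X : R) : Prop :=
  {ae leb, forall x, om x -> `|f x| <= X}.

Lemma ae_leb_on (P : set R) :
  (\forall x \ae leb_on b, P x) <-> {ae leb, forall x, om x -> P x}.
Proof.
split=> -[A [mA A0 PA]].
  exists (A `&` om); split; [exact: measurableI|exact: A0|].
  by move=> x /= /not_implyP[xo nP]; split=> //; exact: PA.
exists (A `|` ~` om); split.
- by apply: measurableU => //; exact: measurableC.
- rewrite /leb_on/= /mrestr setIUl setICl setU0.
  apply/eqP; rewrite eq_le measure_ge0 andbT -A0; apply: le_measure.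
  + by rewrite inE; exact: measurableI.
  + by rewrite inE.
  + exact: subIsetl.
- move=> x nP; have [xo|xo] := pselect (om x); last by right.
  by left; apply: PA => /(_ xo).
Qed.

Lemma leb_omega : leb om = (2 * b)%:E.
Proof.
rewrite /omega lebesgue_measure_itv/= lte_fin gtrN//.
by rewrite -EFinB; congr EFin; ring.
Qed.

Lemma leb_on_gt0 : (0 < leb_on b setT)%E.
Proof. by rewrite /leb_on/= /mrestr setTI leb_omega lte_fin mulr_gt0. Qed.

Lemma normooP f X : (normoo b f <= X%:E)%E <-> ae_bounded f X.
Proof.
rewrite /normoo /ae_bounded -ae_leb_on; split.
  move=> /ess_supP; apply: (@filterS _ _ (@ae_filter_ringOfSetsType _ _ _ (leb_on b))).
  by move=> x; rewrite lee_fin.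
move=> h; apply/ess_supP; move: h; apply: (@filterS _ _ (@ae_filter_ringOfSetsType _ _ _ (leb_on b))).
by move=> x; rewrite lee_fin.
Qed.

Lemma normoo_ge0 f : (0 <= normoo b f)%E.
Proof. by apply: ess_sup_gee; [exact: leb_on_gt0|apply: aeW => x; rewrite lee_fin]. Qed.

Lemma normoo_fin f X : ae_bounded f X ->
  exists Y, [/\ 0 <= Y, normoo b f = Y%:E & ae_bounded f Y].
Proof.
move=> /normooP fX; have fin : normoo b f \is a fin_num.
  by rewrite ge0_fin_numE ?normoo_ge0// (le_lt_trans fX) ?ltry.
exists (fine (normoo b f)); split; [exact/fine_ge0/normoo_ge0|by rewrite fineK|].
by apply/normooP; rewrite fineK.
Qed.

Lemma Linfty0_bounded f : Linfty0 b f ->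
  measurable_fun setT f /\ exists X, ae_bounded f X.
Proof.
case=> /andP[]; rewrite inE => mf; rewrite inE /finite_norm /= => fN z0; split=> //.
have fy : (normoo b f < +oo)%E.
  move: fN; rewrite /finite_norm unlock /Lnorm leb_on_gt0.
  apply: le_lt_trans; apply: le_ess_sup; apply: aeW => x /=.
  by rewrite lexx.
exists (fine (normoo b f)); apply/normooP.
by rewrite fineK// ge0_fin_numE// normoo_ge0.
Qed.

Lemma ae_bounded_integrable f X : measurable_fun setT f -> ae_bounded f X ->
  leb.-integrable om (EFin \o f).
Proof.
move=> mf fX; apply/integrableP; split; first exact/measurable_EFinP/measurable_funTS.
apply: (@le_lt_trans _ _ (\int[leb]_(x in om) `|X|%:E)%E).
  apply: ae_ge0_le_integral => //.
  - by apply: measurableT_comp => //; exact/measurable_EFinP/measurable_funTS.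
  - move: fX; apply: filterS => x h xo; rewrite /= lee_fin (le_trans (h xo))//.
    exact: ler_norm.
by rewrite integral_cst// -[X in (_ * X)%E]/(leb om) leb_omega -EFinM ltry.
Qed.

Lemma ae_le_Rintegral (f g : R -> R) :
  leb.-integrable om (EFin \o f) -> leb.-integrable om (EFin \o g) ->
  (forall x, om x -> 0 <= f x) -> (forall x, om x -> 0 <= g x) ->
  {ae leb, forall x, om x -> f x <= g x} ->
  \int[leb]_(x in om) f x <= \int[leb]_(x in om) g x.
Proof.
move=> fi gi f0 g0 fg; rewrite /Rintegral fine_le//.
- exact: integrable_fin_num fi.
- exact: integrable_fin_num gi.
apply: ae_ge0_le_integral => //.
- by case/integrableP : fi.
- by case/integrableP : gi.
Qed.

Lemma integral_dist y : om y ->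
  leb.-integrable om (EFin \o (fun z => `|y - z|)) /\
  \int[leb]_(z in om) `|y - z| = b ^+ 2 + y ^+ 2.
Proof.
rewrite /omega/= in_itv/= => /andP[by1 by2].
have c1 : continuous (fun z : R => `|y - z|).
  move=> z; apply: (@continuous_comp _ _ _ (fun z => y - z) (fun u => `|u|)).
    by apply: cvgB; [exact: cvg_cst|exact: cvg_id].
  exact: norm_continuous.
have i1 p q := continuous_integrable_itv p q c1.
have io : leb.-integrable om (EFin \o (fun z => `|y - z|)).
  apply: (@integrableS _ _ _ leb _ _ _ _ _ _ (i1 (- b) b)) => //.
  exact: subset_itv_oo_cc.
split => //.
rewrite Rintegral_itv_bndo_bndc// Rintegral_itv_obnd_cbnd; last first.
  apply: (@integrableS _ _ _ leb _ _ _ _ _ _ (i1 (- b) b)) => //.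
  exact: subset_itv_oc_cc.
have -> : `[- b, b]%classic = `[- b, y]%classic `|` `]y, b]%classic.
  by rewrite -itv_bndbnd_setU// bnd_simp ltW.
rewrite Rintegral_setU//; last 2 first.
- by rewrite -itv_bndbnd_setU ?bnd_simp ?ltW//; exact: i1.
- apply/disj_set2P; rewrite -subset0 => z [] /=; rewrite !in_itv/= => /andP[_ zy] /andP[].
  by rewrite ltNge zy.
rewrite Rintegral_itv_obnd_cbnd; last first.
  apply: (@integrableS _ _ _ leb _ _ _ _ _ _ (i1 y b)) => //.
  exact: subset_itv_oc_cc.
transitivity (\int[leb]_(z in `[- b, y]) (y - z) + \int[leb]_(z in `[y, b]) (z - y)).
  congr (_ + _); apply: eq_Rintegral => z; rewrite inE/= in_itv/= => /andP[? ?].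
    by rewrite ger0_norm// subr_ge0.
  by rewrite distrC ger0_norm// subr_ge0.
rewrite (@Rintegral_FTC2 _ (fun z => y - z) (fun z => - ((y - z) ^+ 2 / 2)) (- b) y (ltW by1)).
- rewrite (@Rintegral_FTC2 _ (fun z => z - y) (fun z => (z - y) ^+ 2 / 2) y b (ltW by2)).
  + by field.
  + by move=> z; apply: cvgB; [exact: cvg_id|exact: cvg_cst].
  + move=> z; apply: has_deriv_eq.
      apply: has_derivM; last exact: has_deriv_cst.
      apply: has_derivX; apply: has_derivD; first exact: has_deriv_id.
      by apply: has_derivN; exact: has_deriv_cst.
    by rewrite /=; field.
- by move=> z; apply: cvgB; [exact: cvg_cst|exact: cvg_id].
- move=> z; apply: has_deriv_eq.
    apply: has_derivN; apply: has_derivM; last exact: has_deriv_cst.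
    apply: has_derivX; apply: has_derivD; first exact: has_deriv_cst.
    by apply: has_derivN; exact: has_deriv_id.
  by rewrite /=; field.
Qed.

End ae_bounds.

Section one_time_estimate.
Context {R : realType}.
Local Notation leb := (@lebesgue_measure R).
Variables (sigma tau b : R).
Hypotheses (s0 : 0 < sigma) (tau0 : 0 < tau) (b0 : 0 < b).
Local Notation K := (gauss_kernel sigma tau).
Local Notation E := (gauss_tail sigma tau).
Local Notation m := (sigma ^+ 2 * tau).
Local Notation om := (omega b).
Variables (f0 f1 : R -> R) (X0 X1 : R).
Hypotheses (mf0 : measurable_fun setT f0) (mf1 : measurable_fun setT f1).
Hypotheses (X00 : 0 <= X0) (X10 : 0 <= X1).
Hypotheses (fX0 : ae_bounded b f0 X0) (fX1 : ae_bounded b f1 X1).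

Let m0 : 0 < m. Proof. exact: variance_gt0. Qed.
Let mo : measurable om. Proof. exact: measurable_itv. Qed.

Lemma gauss_kernel_le y u : `|y| <= `|u| -> K u <= K y.
Proof.
move=> yu; rewrite ler_pM2l; last first.
  by rewrite invr_gt0 mulr_gt0// sqrtr_gt0 !mulr_gt0// pi_gt0.
rewrite ler_expR lerN2 ler_pM2r; last by rewrite invr_gt0 !mulr_gt0// exprn_gt0.
by rewrite -(real_normK (num_real y)) -(real_normK (num_real u)) lerXn2r ?nnegrE.
Qed.

(** Bounds for the norms of the operators that send [f0] and [f1] to
    [sigma ^+ 2 / (2 K)] times the superposition of [source2]. *)
Definition norm_op0 : R := 3 * b ^+ 2 / (2 * sigma ^+ 2) / tau.
Definition norm_op1 : R := (b ^+ 2 + b * sigma * Num.sqrt (2 * pi * tau)) / (2 * sigma ^+ 2).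

(** Since [|z| + |y - z| >= |y|], the kernels are controlled by their value at
    [y]; there remain the integrals of [|z|] and [|y - z|] over [omega]. *)
Lemma superposition_bound y : om y ->
  `|\int[leb]_(z in om) source2 sigma tau f0 f1 z `|y - z| |
  <= 2 * K y / sigma ^+ 2 * (norm_op0 * X0 + norm_op1 * X1).
Proof.
move=> yo.
have if0 := ae_bounded_integrable b0 mf0 fX0.
have if1 := ae_bounded_integrable b0 mf1 fX1.
have [B [iB _ w2B _]] := source_bound s0 tau0 b0 if0 if1.
have ms2 : measurable_fun setT (fun z => source2 sigma tau f0 f1 z `|y - z|).
  have my : measurable_fun setT (fun z : R => (y, z)) by exact: measurable_fun_pair.
  exact: (measurableT_comp (measurable_source2 s0 tau0 mf0 mf1) my).
have is2 : leb.-integrable om (EFin \o (fun z => source2 sigma tau f0 f1 z `|y - z|)).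
  apply: (le_integrable_real mo (measurable_funTS ms2) _ iB).
  by move=> z zo; exact: w2B.
pose M := sigma * Num.sqrt (2 * pi * tau) / 2.
have M0 : 0 <= M by rewrite !mulr_ge0// ?sqrtr_ge0// ltW.
have K0 : 0 < K y by exact: gauss_kernel_gt0.
have s2 : 0 < sigma ^+ 2 by rewrite exprn_gt0.
have zo : om 0 by rewrite /omega/= in_itv/= oppr_lt0 b0.
have [iy ey] := integral_dist yo; have [iz ez] := integral_dist zo.
pose c0 := X0 / (2 * m); pose c1 := X1 / (2 * sigma ^+ 2).
pose G z := 2 * K y / sigma ^+ 2 * (c0 * (`|0 - z| + `|y - z|) + c1 * (`|0 - z| + M)).
have icst (c : R) : leb.-integrable om (EFin \o (fun=> c)).
  have cc : continuous (fun _ : R => c) by move=> x; exact: cvg_cst.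
  have h := continuous_integrable_itv (- b) b cc.
  apply: (@integrableS _ _ _ leb _ _ _ _ _ _ h) => //.
  exact: subset_itv_oo_cc.
have i1 := integrable_realZ c0 mo (integrable_realD mo iz iy).
have i2 := integrable_realZ c1 mo (integrable_realD mo iz (icst M)).
have iG : leb.-integrable om (EFin \o G).
  by apply: integrable_realZ => //; exact: integrable_realD.
have c00 : 0 <= c0 by rewrite divr_ge0// mulr_ge0// ltW.
have c10 : 0 <= c1 by rewrite divr_ge0// mulr_ge0// ltW.
have k0 : 0 <= 2 * K y / sigma ^+ 2.
  by apply: divr_ge0; [apply: mulr_ge0 => //; exact: ltW|exact: ltW].
apply: (@le_trans _ _ (\int[leb]_(z in om) `|source2 sigma tau f0 f1 z `|y - z| |)).
  exact: le_normr_Rintegral.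
apply: (@le_trans _ _ (\int[leb]_(z in om) G z)).
  apply: ae_le_Rintegral => //; first exact: integrable_norm.
    move=> z _; apply: mulr_ge0 => //.
    by apply: addr_ge0; apply: mulr_ge0 => //; exact: addr_ge0.
  move: fX0 fX1; apply: filterS2 => z h0 h1 zo'.
  have {}h0 := h0 zo'; have {}h1 := h1 zo'.
  rewrite /G /source2 sub0r normrN.
  set u := `|z| + `|y - z|.
  have u0 : 0 <= u by exact: addr_ge0.
  have yu : `|y| <= u.
    by rewrite -{1}(subrK z y) addrC (le_trans (ler_normD _ _)).
  have Ku : K u <= K y by apply: gauss_kernel_le; rewrite (ger0_norm u0).
  have Eu : E u <= M * K y.
    rewrite (le_trans (gauss_tail_nincr s0 tau0 yu))//.
    by rewrite -(gauss_kernel_norm _ _ y) gauss_tail_le_mills.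
  have Ku0 : 0 <= K u by exact/ltW/gauss_kernel_gt0.
  have Eu0 : 0 <= E u by exact: gauss_tail_ge0.
  rewrite (le_trans (ler_normD _ _))// mulrDr lerD//.
    rewrite normrM [leRHS](_ : _ = u / m * K y / sigma ^+ 2 * X0); last first.
      by rewrite /c0; field; rewrite !gt_eqF.
    rewrite ler_pM//.
    rewrite ger0_norm; last first.
      by apply: divr_ge0; [apply: mulr_ge0 => //; apply: divr_ge0 => //|]; exact: ltW.
    by rewrite ler_pM2r ?invr_gt0// ler_wpM2l// divr_ge0// ltW.
  rewrite normrM [leRHS](_ : _ = (`|z| * K y + M * K y) / sigma ^+ 4 * X1); last first.
    by rewrite /c1; field; rewrite !gt_eqF.
  rewrite ler_pM//.
  have s4 : 0 < (sigma ^+ 4)^-1 by rewrite invr_gt0 exprn_gt0.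
  rewrite ger0_norm; last first.
    by apply: mulr_ge0; [apply: addr_ge0 => //; exact: mulr_ge0|exact: ltW].
  by rewrite ler_pM2r// lerD// ler_wpM2l.
have -> : \int[leb]_(z in om) G z = 2 * K y / sigma ^+ 2 *
    (c0 * (b ^+ 2 + 0 ^+ 2 + (b ^+ 2 + y ^+ 2)) + c1 * (b ^+ 2 + 0 ^+ 2 + M * (2 * b))).
  have cM : \int[leb]_(z in om) M = M * (2 * b).
    by rewrite Rintegral_cst// -[X in fine X]/(leb om) leb_omega.
  rewrite RintegralZl//; last exact: integrable_realD.
  congr (_ * _); rewrite RintegralD//.
  rewrite RintegralZl//; last exact: integrable_realD.
  rewrite RintegralZl//; last exact: integrable_realD.
  by rewrite RintegralD// RintegralD// ey ez cM.
rewrite ler_wpM2l// expr0n/= addr0 lerD//.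
  rewrite /norm_op0 [leRHS](_ : _ = c0 * (3 * b ^+ 2)); last first.
    by rewrite /c0; field; rewrite !gt_eqF.
  rewrite ler_wpM2l//.
  have : y ^+ 2 <= b ^+ 2.
    rewrite -(real_normK (num_real y)) lerXn2r ?nnegrE ?(ltW b0)//.
    by move: yo; rewrite /omega/= in_itv/= -ltr_norml => /ltW.
  lra.
rewrite /norm_op1 le_eqVlt; apply/orP; left; apply/eqP.
by rewrite /c1 /M; field; rewrite !gt_eqF.
Qed.

(** The Dirac part of the second derivative is a multiple of [f0 + tau * f1],
    with a coefficient that is smallest at the ends of [omega]. *)
Lemma source_bound_at y : om y ->
  `|f0 y + tau * f1 y| <= sigma ^+ 2 / (2 * K b) * `|source_potential2 sigma tau b f0 f1 y|
     + (norm_op0 * X0 + norm_op1 * X1).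
Proof.
move=> yo; have K0 : 0 < K y by exact: gauss_kernel_gt0.
have Kb : 0 < K b by exact: gauss_kernel_gt0.
have s2 : 0 < sigma ^+ 2 by rewrite exprn_gt0.
have Kby : K b <= K y.
  apply: gauss_kernel_le; rewrite (gtr0_norm b0).
  by move: yo; rewrite /omega/= in_itv/= -ltr_norml => /ltW.
have sb := superposition_bound yo.
rewrite /source_potential2 /superposition2 source1_at0//.
move: sb; set I := Rintegral _ _ _ => sb; set N := _ + norm_op1 * X1 in sb *.
set F := f0 y + tau * f1 y; set g := I + _.
have FE : F = sigma ^+ 2 / (2 * K y) * (I - g).
  by rewrite /g; field; rewrite !gt_eqF.
rewrite FE normrM gtr0_norm; last by rewrite divr_gt0// mulr_gt0.
have k0 : 0 < sigma ^+ 2 / (2 * K y) by rewrite divr_gt0// mulr_gt0.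
apply: (@le_trans _ _ (sigma ^+ 2 / (2 * K y) * (`|g| + `|I|))).
  by rewrite ler_pM2l// [leRHS]addrC ler_normB.
rewrite mulrDr lerD//.
  have k2y : 0 < 2 * K y by apply: mulr_gt0.
  have k2b : 0 < 2 * K b by apply: mulr_gt0.
  by rewrite ler_wpM2r// ler_pM2l// lef_pV2 ?posrE// ler_pM2l.
apply: (@le_trans _ _ (sigma ^+ 2 / (2 * K y) * (2 * K y / sigma ^+ 2 * N))).
  by rewrite ler_pM2l.
rewrite le_eqVlt; apply/orP; left; apply/eqP.
by field; rewrite !gt_eqF.
Qed.

End one_time_estimate.

(** * Functions orthogonal to bumps *)

Section null_of_pairings.
Context {R : realType}.
Local Notation leb := (@lebesgue_measure R).
Variable b : R.
Local Notation om := (omega b).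

Let mo : measurable om. Proof. exact: measurable_itv. Qed.

(** Polynomials that vanish to second order at [x - r] and [x + r], followed by
    their derivatives: the pairing formula needs no more at the end points. *)
Definition quartic_bump (x r y : R) : R := (r ^+ 2 - (y - x) ^+ 2) ^+ 2.
Definition quartic_bump1 (x r y : R) : R := - 4 * (r ^+ 2 - (y - x) ^+ 2) * (y - x).
Definition quartic_bump2 (x r y : R) : R := - 4 * (r ^+ 2 - 3 * (y - x) ^+ 2).

Let dshift (x y : R) : has_deriv (fun y => y - x) y 1.
Proof.
apply: has_deriv_eq; last exact: addr0.
by apply: has_derivD; [exact: has_deriv_id|rewrite -oppr0; apply: has_derivN; exact: has_deriv_cst].
Qed.

Lemma quartic_bump_deriv x r y : has_deriv (quartic_bump x r) y (quartic_bump1 x r y).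
Proof.
apply: has_deriv_eq.
  apply: has_derivX; apply: has_derivD; first exact: has_deriv_cst.
  by apply: has_derivN; apply: has_derivX; exact: dshift.
by rewrite /= /quartic_bump1; ring.
Qed.

Lemma quartic_bump1_deriv x r y : has_deriv (quartic_bump1 x r) y (quartic_bump2 x r y).
Proof.
apply: has_deriv_eq.
  apply: has_derivM; last exact: dshift.
  apply: has_derivM; first exact: has_deriv_cst.
  apply: has_derivD; first exact: has_deriv_cst.
  by apply: has_derivN; apply: has_derivX; exact: dshift.
by rewrite /= /quartic_bump2; ring.
Qed.

Lemma quartic_bump2_continuous x r : continuous (quartic_bump2 x r).
Proof.
move=> y; apply: (@has_deriv_continuous _ _ _ (- 4 * - (3 * (2 * (y - x))))).
apply: has_deriv_eq.
  apply: has_derivM; first exact: has_deriv_cst.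
  apply: has_derivD; first exact: has_deriv_cst.
  apply: has_derivN; apply: has_derivM; first exact: has_deriv_cst.
  by apply: has_derivX; exact: dshift.
by rewrite /=; ring.
Qed.

Let quartic_bump_continuous x r : continuous (quartic_bump x r).
Proof. by move=> y; exact: has_deriv_continuous (quartic_bump_deriv x r y). Qed.

Let quartic_bump_integrable x r p q : leb.-integrable `]p, q[ (EFin \o quartic_bump x r).
Proof.
apply: (@integrableS _ _ _ leb _ _ _ _ _ _
  (continuous_integrable_itv p q (@quartic_bump_continuous x r))) => //.
exact: subset_itv_oo_cc.
Qed.

Lemma integral_quartic_bump x r : 0 < r ->
  \int[leb]_(y in `]x - r, x + r[) quartic_bump x r y = 16 / 15 * r ^+ 5.
Proof.
move=> r0.
rewrite Rintegral_itv_bndo_bndc ?Rintegral_itv_obnd_cbnd//; last first.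
  apply: (@integrableS _ _ _ leb _ _ _ _ _ _
    (continuous_integrable_itv (x - r) (x + r) (@quartic_bump_continuous x r))) => //.
  exact: subset_itv_oc_cc.
rewrite (@Rintegral_FTC2 _ _ (fun y => (y - x) *
   (r ^+ 4 - 2 / 3 * r ^+ 2 * (y - x) ^+ 2 + 1 / 5 * ((y - x) ^+ 2) ^+ 2))).
- by field.
- by lra.
- exact: quartic_bump_continuous.
- move=> y; apply: has_deriv_eq.
    apply: has_derivM; first exact: dshift.
    apply: has_derivD.
      apply: has_derivD; first exact: has_deriv_cst.
      apply: has_derivN; apply: has_derivM; first exact: has_deriv_cst.
      by apply: has_derivX; exact: dshift.
    apply: has_derivM; first exact: has_deriv_cst.
    by apply: has_derivX; apply: has_derivX; exact: dshift.
  by rewrite /= /quartic_bump; field.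
Qed.

(** At a Lebesgue point [x] of [g], the normalized mean of [g] against
    the bump concentrated at [x] tends to [g x]. *)
Lemma ae_null_of_pairings (g : R -> R) :
  leb.-integrable om (EFin \o g) ->
  (forall x r, - b <= x - r -> 0 < r -> x + r <= b ->
    \int[leb]_(y in `]x - r, x + r[) (g y * quartic_bump x r y) = 0) ->
  {ae leb, forall x, om x -> g x = 0}.
Proof.
move=> ig gb.
have := lebesgue_differentiation (integrable_locally_restrict mo ig).
apply: filterS => x lpt xo.
apply/eqP; rewrite -normr_eq0; apply/negP => /negP gx.
have gx0 : 0 < `|g x| by rewrite lt_def gx normr_ge0.
(* The integral of the bump is 16 / 15 r ^+ 5 and its maximum r ^+ 4, on an
   interval of length 2 r; hence the mean oscillation of g at x is at least
   8 / 15 |g x|. *)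
have : \forall r \near 0^'+, (davg (g \_ om) x r < (8 / 15 * `|g x|)%:E)%E.
  have := lpt; rewrite /lebesgue_pt => /(_ [set e | (e < (8 / 15 * `|g x|)%:E)%E]); apply.
  apply: (@open_nbhs_nbhs (\bar R)); split; first exact: open_ereal_lt_ereal.
  by rewrite /= lte_fin mulr_gt0// divr_gt0.
move=> dr.
have [bx xb] : - b < x /\ x < b by move: xo; rewrite /omega/= in_itv/= => /andP.
near (0 : R)^'+ => r.
have r0 : 0 < r by [].
have rb : r <= x + b by near: r; apply: nbhs_right_le; lra.
have rb' : r <= b - x by near: r; apply: nbhs_right_le; lra.
have : (davg (g \_ om) x r < (8 / 15 * `|g x|)%:E)%E by near: r.
apply/negP; rewrite -leNgt.
have xr1 : - b <= x - r by lra.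
have xr2 : x + r <= b by lra.
have Io : `]x - r, x + r[%classic `<=` om.
  move=> y; rewrite /omega/= !in_itv/= => /andP[y1 y2].
  by apply/andP; split; lra.
have mI : measurable `]x - r, x + r[%classic by exact: measurable_itv.
have igI : leb.-integrable `]x - r, x + r[ (EFin \o g).
  exact: (@integrableS _ _ _ leb _ _ _ mo mI Io ig).
have icst : leb.-integrable `]x - r, x + r[ (EFin \o (fun=> g x)).
  have cc : continuous (fun _ : R => g x) by move=> y; exact: cvg_cst.
  apply: (@integrableS _ _ _ leb _ _ _ _ _ _
    (continuous_integrable_itv (x - r) (x + r) cc)) => //.
  exact: subset_itv_oo_cc.
have idiff : leb.-integrable `]x - r, x + r[ (EFin \o (fun y => g y - g x)).
  have := integrable_realD mI igI (integrable_realZ (-1) mI icst).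
  by apply: eq_integrable => // y _ /=; rewrite mulN1r.
have bump0 y : 0 <= quartic_bump x r y by exact: sqr_ge0.
have bumpr y : `]x - r, x + r[%classic y -> quartic_bump x r y <= r ^+ 4.
  rewrite /= in_itv/= => /andP[y1 y2].
  have h : (y - x) ^+ 2 <= r ^+ 2.
    rewrite -(real_normK (num_real (y - x))) lerXn2r ?nnegrE ?(ltW r0)//.
    by rewrite ler_norml; apply/andP; split; lra.
  rewrite /quartic_bump -[4%N]/(2 * 2)%N exprM lerXn2r ?nnegrE ?sqr_ge0 ?subr_ge0//.
  by rewrite gerBl sqr_ge0.
have mbump : measurable_fun setT (quartic_bump x r) by exact: continuous_measurable_fun.
have mg : measurable_fun `]x - r, x + r[ g by case/integrableP : igI => /measurable_EFinP.
have mdiff : measurable_fun `]x - r, x + r[ (fun y => g y - g x).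
  by apply: measurable_funB.
pose N := \int[leb]_(y in `]x - r, x + r[) `|g y - g x|.
have iprod : leb.-integrable `]x - r, x + r[ (EFin \o (fun y => (g y - g x) * quartic_bump x r y)).
  apply: (le_integrable_real mI _ _ (integrable_realZ (r ^+ 4) mI (integrable_norm idiff))).
    by apply: measurable_funM => //; exact: measurable_funTS.
  by move=> y yI; rewrite normrM (ger0_norm (bump0 y)) mulrC ler_wpM2r// bumpr.
have ibg : leb.-integrable `]x - r, x + r[ (EFin \o (fun y => g x * quartic_bump x r y)).
  exact: integrable_realZ.
have key : g x * (16 / 15 * r ^+ 5)
    = - \int[leb]_(y in `]x - r, x + r[) ((g y - g x) * quartic_bump x r y).
  rewrite -(integral_quartic_bump x r0) -RintegralZl//.
  apply/eqP; rewrite -addr_eq0 -RintegralD//.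
  apply/eqP; rewrite -[RHS](gb x r)//.
  by apply: eq_Rintegral => y _; ring.
have : `|g x| * (16 / 15 * r ^+ 5) <= r ^+ 4 * N.
  have r5 : 0 <= 16 / 15 * r ^+ 5 by rewrite mulr_ge0// exprn_ge0// ltW.
  rewrite -{1}(ger0_norm r5) -normrM key normrN.
  apply: (@le_trans _ _ (\int[leb]_(y in `]x - r, x + r[) `|(g y - g x) * quartic_bump x r y|)).
    exact: le_normr_Rintegral.
  rewrite /N -RintegralZl//; last exact: integrable_norm.
  apply: le_Rintegral => //; first exact: integrable_norm.
    exact: (integrable_realZ (r ^+ 4) mI (integrable_norm idiff)).
  by move=> y yI; rewrite normrM (ger0_norm (bump0 y)) mulrC ler_wpM2r// bumpr.
move=> kN.
have xr : 8 / 15 * `|g x| <= (r *+ 2)^-1 * N.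
  rewrite -(ler_pM2l (_ : 0 < 2 * r ^+ 5)); last by rewrite mulr_gt0// exprn_gt0.
  have -> : 2 * r ^+ 5 * (8 / 15 * `|g x|) = `|g x| * (16 / 15 * r ^+ 5) by field.
  have -> : 2 * r ^+ 5 * ((r *+ 2)^-1 * N) = r ^+ 4 * N.
    by rewrite -mulr_natr; field; rewrite gt_eqF.
  exact: kN.
rewrite /davg /iavg (lebesgue_measure_ball _ (ltW r0))/= ball_itv.
have -> : (\int[leb]_(y in `](x - r)%R, (x + r)%R[) `|(center ((g \_ om) x) \o (g \_ om)) y|%:E)%E = N%:E.
  rewrite /N /Rintegral fineK; last first.
    exact: (@integrable_fin_num _ _ _ leb _ mI _ (integrable_norm idiff)).
  apply: eq_integral => y; rewrite inE => yI; rewrite /= !patchE !mem_set//.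
  exact: Io.
by rewrite inver mulrn_eq0 (gt_eqF r0)/= -EFinM lee_fin.
Unshelve. all: by end_near. Qed.

End null_of_pairings.

(** * Contraction and stability *)

Section contraction.
Context {R : realType}.

(** In the norm [|f0| + sqrt (tau1 tau2) |f1|] the coefficients of [X0] and [X1] are
    the slacks of the two smallness conditions, with [t j = sqrt (tau j)]. *)
Lemma contraction (t1 t2 a k1 k2 X0 X1 G1 G2 : R) : 0 < t1 -> t1 < t2 ->
  let Q1 := G1 + (a / t1 ^+ 2 * X0 + k1 * X1) in
  let Q2 := G2 + (a / t2 ^+ 2 * X0 + k2 * X1) in
  X0 * (t2 ^+ 2 - t1 ^+ 2) <= t2 ^+ 2 * Q1 + t1 ^+ 2 * Q2 ->
  X1 * (t2 ^+ 2 - t1 ^+ 2) <= Q1 + Q2 ->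
  (t2 - t1 - (t2 / t1 ^+ 2 + t1 / t2 ^+ 2) * a) * X0
  + (t1 * t2 * (t2 - t1) - (t2 * k1 + t1 * k2)) * X1 <= t2 * G1 + t1 * G2.
Proof.
move=> t10 t12 Q1 Q2 h0 h1; have t20 := lt_trans t10 t12.
have d0 : 0 < t1 + t2 by exact: addr_gt0.
have : (t1 + t2) * ((X0 + t1 * t2 * X1) * (t2 - t1)) <= (t1 + t2) * (t2 * Q1 + t1 * Q2).
  have h1' : t1 * t2 * (X1 * (t2 ^+ 2 - t1 ^+ 2)) <= t1 * t2 * (Q1 + Q2).
    by rewrite ler_wpM2l// mulr_ge0// ltW.
  have := lerD h0 h1'; congr (is_true (_ <= _)); ring.
rewrite ler_pM2l// -subr_ge0 => h; rewrite -subr_ge0.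
by move: h; congr (is_true (0 <= _)); rewrite /Q1 /Q2; field; rewrite !gt_eqF.
Qed.

Lemma smallness0 (sigma tau1 tau2 b t1 t2 : R) : 0 < sigma -> 0 < t1 -> t1 < t2 ->
  tau1 = t1 ^+ 2 -> tau2 = t2 ^+ 2 ->
  (tau1 ^+ 2 + tau2 ^+ 2 + Num.sqrt (tau1 * tau2) * (tau1 + tau2))
    / (tau1 * tau2 * (tau2 - tau1)) * (3 * b ^+ 2 / (2 * sigma ^+ 2)) < 1 ->
  0 < t2 - t1 - (t2 / t1 ^+ 2 + t1 / t2 ^+ 2) * (3 * b ^+ 2 / (2 * sigma ^+ 2)).
Proof.
move=> s0 t10 t12 -> -> h; have t20 := lt_trans t10 t12.
have d0 : 0 < t2 - t1 by rewrite subr_gt0.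
rewrite subr_gt0 -[ltRHS]mul1r -ltr_pdivrMr//; move: h.
rewrite -exprMn sqrtr_sqr gtr0_norm ?mulr_gt0//.
set al := 3 * b ^+ 2 / _; congr (is_true (_ < 1)).
have e : t2 ^+ 2 - t1 ^+ 2 = (t2 - t1) * (t1 + t2) by ring.
by rewrite e; field; rewrite !gt_eqF// addr_gt0.
Qed.

Lemma smallness1 (sigma tau1 tau2 b t1 t2 : R) : 0 < sigma -> 0 < t1 -> t1 < t2 ->
  tau1 = t1 ^+ 2 -> tau2 = t2 ^+ 2 ->
  ((Num.sqrt (tau1 / tau2) + Num.sqrt (tau2 / tau1) + 2) * (b ^+ 2 / sigma ^+ 2)
     + 2 * Num.sqrt (2 * pi) * (Num.sqrt tau1 + Num.sqrt tau2) * (b / sigma))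
    / (2 * (tau2 - tau1)) < 1 ->
  0 < t1 * t2 * (t2 - t1) - (t2 * norm_op1 sigma tau1 b + t1 * norm_op1 sigma tau2 b).
Proof.
move=> s0 t10 t12 -> -> h; have t20 := lt_trans t10 t12.
have d0 : 0 < t2 - t1 by rewrite subr_gt0.
have p0 : 0 < t1 * t2 * (t2 - t1) by rewrite !mulr_gt0.
rewrite subr_gt0 -[ltRHS]mul1r -ltr_pdivrMr//; move: h; rewrite /norm_op1.
rewrite -!expr_div_n ![Num.sqrt (2 * pi * _ ^+ 2)]sqrtrM ?mulr_ge0 ?pi_ge0// !sqrtr_sqr.
rewrite !gtr0_norm ?divr_gt0//.
set P := Num.sqrt (2 * pi); congr (is_true (_ < 1)).
have e : t2 ^+ 2 - t1 ^+ 2 = (t2 - t1) * (t1 + t2) by ring.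
by rewrite e; field; rewrite !gt_eqF// addr_gt0.
Qed.

End contraction.

Section stability.
Context {R : realType}.
Local Notation leb := (@lebesgue_measure R).
Variables (s sigma tau1 tau2 b : R).
Hypotheses (s_gt0 : 0 < s) (s0 : 0 < sigma) (tau10 : 0 < tau1) (tau12 : tau1 < tau2).
Hypotheses (b0 : 0 < b).
Hypothesis small0 : (tau1 ^+ 2 + tau2 ^+ 2 + Num.sqrt (tau1 * tau2) * (tau1 + tau2))
    / (tau1 * tau2 * (tau2 - tau1)) * (3 * b ^+ 2 / (2 * sigma ^+ 2)) < 1.
Hypothesis small1 :
  ((Num.sqrt (tau1 / tau2) + Num.sqrt (tau2 / tau1) + 2) * (b ^+ 2 / sigma ^+ 2)
     + 2 * Num.sqrt (2 * pi) * (Num.sqrt tau1 + Num.sqrt tau2) * (b / sigma))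
    / (2 * (tau2 - tau1)) < 1.
Local Notation om := (omega b).

Let tau20 : 0 < tau2. Proof. exact: lt_trans tau12. Qed.

(** The second derivative of the datum [W] at time [tau], by
    [untilted_weak_derivative2]. *)
Definition data_deriv2 tau (f0 f1 : R -> R) y : R := s * source_potential2 sigma tau b f0 f1 y.

(** Almost everywhere, [f0] and [f1] are linear combinations of the two sums
    [f0 + tau_j f1], each bounded by [Q tau_j]; [contraction] absorbs the part
    of [Q] that contains their own norms. *)
Lemma stability : exists C : R, forall f0 f1 X0 X1,
  measurable_fun setT f0 -> measurable_fun setT f1 ->
  ae_bounded b f0 X0 -> ae_bounded b f1 X1 ->
  (normoo b f0 + normoo b f1
   <= C%:E * (normoo b (data_deriv2 tau1 f0 f1) + normoo b (data_deriv2 tau2 f0 f1)))%E.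
Proof.
pose t1 := Num.sqrt tau1; pose t2 := Num.sqrt tau2.
have t1E : tau1 = t1 ^+ 2 by rewrite sqr_sqrtr ?ltW.
have t2E : tau2 = t2 ^+ 2 by rewrite sqr_sqrtr ?ltW.
have t10 : 0 < t1 by rewrite sqrtr_gt0.
have t20 : 0 < t2 by rewrite sqrtr_gt0.
have t12 : t1 < t2 by rewrite ltr_sqrt.
have e0 := smallness0 s0 t10 t12 t1E t2E small0.
have e1 := smallness1 s0 t10 t12 t1E t2E small1.
set e0' := _ - _ in e0; set e1' := _ - _ in e1.
pose e := Num.min e0' e1'.
have egt0 : 0 < e by rewrite lt_min e0 e1.
pose c tau := sigma ^+ 2 / (2 * gauss_kernel sigma tau b) / s.
have c0 tau : 0 < tau -> 0 < c tau.
  move=> tau0; apply: divr_gt0 => //; apply: divr_gt0; first exact: exprn_gt0.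
  by apply: mulr_gt0 => //; exact: gauss_kernel_gt0.
pose C := (t2 * c tau1 + t1 * c tau2) / e.
have C0 : 0 < C.
  by apply: divr_gt0 => //; apply: addr_gt0; apply: mulr_gt0 => //; exact: c0.
exists C => f0 f1 Y0 Y1 mf0 mf1 fY0 fY1.
have [X0 [X00 nX0 fX0]] := normoo_fin b0 fY0.
have [X1 [X10 nX1 fX1]] := normoo_fin b0 fY1.
have [y1|y1] := eqVneq (normoo b (data_deriv2 tau1 f0 f1)) +oo%E.
  by rewrite y1 addye ?gt0_muley ?lte_fin ?leey// gt_eqF// (lt_le_trans _ (normoo_ge0 b0 _))// ltNy0.
have [y2|y2] := eqVneq (normoo b (data_deriv2 tau2 f0 f1)) +oo%E.
  by rewrite y2 addey ?gt0_muley ?lte_fin ?leey// gt_eqF// (lt_le_trans _ (normoo_ge0 b0 _))// ltNy0.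
have gfin tau : normoo b (data_deriv2 tau f0 f1) != +oo%E -> exists G, [/\ 0 <= G,
    normoo b (data_deriv2 tau f0 f1) = G%:E & ae_bounded b (data_deriv2 tau f0 f1) G].
  move=> gy; have fin : normoo b (data_deriv2 tau f0 f1) \is a fin_num.
    by rewrite ge0_fin_numE ?ltey// normoo_ge0.
  exists (fine (normoo b (data_deriv2 tau f0 f1))); split; [exact/fine_ge0/normoo_ge0|by rewrite fineK|].
  by apply/normooP; rewrite fineK.
have [G1 [G10 nG1 gG1]] := gfin _ y1.
have [G2 [G20 nG2 gG2]] := gfin _ y2.
rewrite nX0 nX1 nG1 nG2 -!EFinD -EFinM lee_fin.
pose Q tau G := c tau * G + (norm_op0 sigma tau b * X0 + norm_op1 sigma tau b * X1).
have FQ tau G : 0 < tau -> forall y, om y -> `|data_deriv2 tau f0 f1 y| <= G ->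
    `|f0 y + tau * f1 y| <= Q tau G.
  move=> tau0 y yo yG.
  apply: (le_trans (source_bound_at s0 tau0 b0 mf0 mf1 X00 X10 fX0 fX1 yo)).
  rewrite lerD2r /c -[leRHS]mulrA ler_pM2l; last first.
    apply: divr_gt0; first exact: exprn_gt0.
    by apply: mulr_gt0 => //; exact: gauss_kernel_gt0.
  by rewrite ler_pdivlMl// -{1}(gtr0_norm s_gt0) -normrM.
set Q1 := Q tau1 G1; set Q2 := Q tau2 G2.
have d0 : 0 < tau2 - tau1 by rewrite subr_gt0.
have b1 : X1 * (tau2 - tau1) <= Q1 + Q2.
  rewrite -ler_pdivlMr// -lee_fin -nX1; apply/normooP.
  move: gG1 gG2; apply: filterS2 => y h1 h2 yo.
  have F1 := FQ _ _ tau10 _ yo (h1 yo); have F2 := FQ _ _ tau20 _ yo (h2 yo).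
  rewrite ler_pdivlMr// -{1}(gtr0_norm d0) -normrM.
  have -> : f1 y * (tau2 - tau1) = (f0 y + tau2 * f1 y) - (f0 y + tau1 * f1 y) by ring.
  by rewrite (le_trans (ler_normB _ _))// addrC lerD.
have b2 : X0 * (tau2 - tau1) <= tau2 * Q1 + tau1 * Q2.
  rewrite -ler_pdivlMr// -lee_fin -nX0; apply/normooP.
  move: gG1 gG2; apply: filterS2 => y h1 h2 yo.
  have F1 := FQ _ _ tau10 _ yo (h1 yo); have F2 := FQ _ _ tau20 _ yo (h2 yo).
  rewrite ler_pdivlMr// -{1}(gtr0_norm d0) -normrM.
  have -> : f0 y * (tau2 - tau1) = tau2 * (f0 y + tau1 * f1 y) - tau1 * (f0 y + tau2 * f1 y) by ring.
  rewrite (le_trans (ler_normB _ _))// !normrM (gtr0_norm tau10) (gtr0_norm tau20).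
  by rewrite lerD// ler_pM2l.
have main : e0' * X0 + e1' * X1 <= t2 * (c tau1 * G1) + t1 * (c tau2 * G2).
  apply: contraction => //; rewrite -t1E -t2E.
    exact: b2.
  exact: b1.
rewrite /C mulrAC ler_pdivlMr//.
apply: (@le_trans _ _ (e0' * X0 + e1' * X1)).
  by rewrite mulrC mulrDr lerD// ler_wpM2r// /e ge_min lexx ?orbT.
apply: (le_trans main).
have A0 : 0 <= t2 * c tau1 by apply: mulr_ge0; exact/ltW/c0 || exact: ltW.
have B0 : 0 <= t1 * c tau2 by apply: mulr_ge0; exact/ltW/c0 || exact: ltW.
rewrite -subr_ge0; set A := t2 * c tau1 in A0 *; set B := t1 * c tau2 in B0 *.
have -> : (A + B) * (G1 + G2) - (t2 * (c tau1 * G1) + t1 * (c tau2 * G2)) = A * G2 + B * G1.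
  by rewrite /A /B; ring.
by apply: addr_ge0; exact: mulr_ge0.
Qed.

End stability.

(** * The inverse problem *)

Section inverse_problem.
Context {R : realType}.
Local Notation leb := (@lebesgue_measure R).
Variables (s sigma mu r tau b : R).
Hypotheses (s_gt0 : 0 < s) (s0 : 0 < sigma) (tau0 : 0 < tau) (b0 : 0 < b).
Local Notation om := (omega b).

Let mo : measurable om. Proof. exact: measurable_itv. Qed.

(** The exponential factor that turns the given equation into the heat equation. *)
Definition untilted (V : R -> R) y : R :=
  expR (- coef_c sigma mu * y - coef_d sigma mu r * tau) * V y.

Lemma untiltedE V f0 f1 : Linfty0 b f0 -> Linfty0 b f1 ->
  (forall y, om y -> cauchy_solution s sigma mu r f0 f1 y tau = V y) ->
  forall y, om y -> untilted V y = s * source_potential sigma tau b f0 f1 y.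
Proof.
move=> L0 L1 fV y yo; have [mf0 [X0 fX0]] := Linfty0_bounded b0 L0.
have [mf1 [X1 fX1]] := Linfty0_bounded b0 L1.
have if0 := ae_bounded_integrable b0 mf0 fX0; have if1 := ae_bounded_integrable b0 mf1 fX1.
have sn0 : s != 0 by rewrite gt_eqF.
rewrite /untilted -(fV _ yo).
rewrite (cauchy_solutionE mu r sn0 s0 tau0 mf0 mf1 if0 if1 L0.2 L1.2).
by rewrite !mulrA -expRD mulNr -opprD addNr expR0 mul1r.
Qed.

(** The support is compact in the open interval, so the function vanishes near
    each point outside. *)
Lemma test_function_boundary (phi : R -> R) x : test_function b phi ->
  ~ om x -> phi x = 0 /\ derive1 phi x = 0.
Proof.
move=> [dphi [K [cK Ko] phi0]] xo.
have nK y : ~ om y -> ~ K y by move=> yo /Ko.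
split; first exact/phi0/nK.
have KC : open (~` K) by apply: closed_openC; apply: compact_closed cK; exact: Rhausdorff.
have nx : \forall y \near x, phi y = cst 0 y.
  have : nbhs x (~` K) by apply: open_nbhs_nbhs; split => //; exact: nK.
  by apply: filterS => y Ky; rewrite phi0.
by rewrite derive1E (near_eq_derive _ nx) ?derive_cst// oner_neq0.
Qed.

Lemma untilted_weak_derivative2 V f0 f1 : Linfty0 b f0 -> Linfty0 b f1 ->
  (forall y, om y -> cauchy_solution s sigma mu r f0 f1 y tau = V y) ->
  is_weak_derivative2 b (untilted V) (data_deriv2 s sigma b tau f0 f1).
Proof.
move=> L0 L1 fV; have WE := untiltedE L0 L1 fV.
have [mf0 [X0 fX0]] := Linfty0_bounded b0 L0.
have [mf1 [X1 fX1]] := Linfty0_bounded b0 L1.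
have if0 := ae_bounded_integrable b0 mf0 fX0; have if1 := ae_bounded_integrable b0 mf1 fX1.
have [iW ig] := source_potential_integrable s0 tau0 b0 mf0 mf1 if0 if1.
have oo : open om by exact: interval_open.
split.
- apply: open_integrable_locally => //.
  apply: eq_integrable (integrable_realZ s mo iW) => // y.
  by rewrite inE => yo; rewrite /= WE.
- by apply: open_integrable_locally => //; exact: integrable_realZ.
- move=> phi tphi.
  have [nb1 nb2] : ~ om (- b) /\ ~ om b.
    by rewrite /omega/= !in_itv/= !ltxx andbF.
  have [p1 p1'] := test_function_boundary tphi nb1.
  have [p2 p2'] := test_function_boundary tphi nb2.
  case: tphi => dphi _.
  have dn n x : has_deriv (fun y => s * derive1n n phi y) x (s * derive1n n.+1 phi x).
    apply: has_deriv_eq.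
      apply: has_derivM; first exact: has_deriv_cst.
      exact: derive1_has_deriv (dphi n x).
    by rewrite mulr0 addr0 derive1nS.
  (* The factor s is moved to the test function. *)
  have := @source_potential_weak_derivative R sigma tau b s0 tau0 b0 f0 f1 mf0 mf1 if0 if1
    (fun y => s * phi y) (fun y => s * derive1 phi y) (fun y => s * derive1n 2 phi y) (- b) b.
  move=> /(_ (dn 0) (dn 1)).
  have c2 : continuous (fun y => s * derive1n 2 phi y).
    by move=> x; exact: has_deriv_continuous (dn 2 x).
  have bb : - b < b by rewrite gtrN.
  move=> /(_ c2 (lexx _) bb (lexx _)).
  rewrite p1 p2 p1' p2' mulr0 => /(_ erefl erefl erefl erefl) e.
  transitivity (\int[leb]_(y in `]- b, b[) (source_potential sigma tau b f0 f1 y * (s * derive1n 2 phi y))).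
    by apply: eq_Rintegral => y; rewrite inE => yo; rewrite WE// mulrCA mulrA.
  rewrite e; apply: eq_Rintegral => y _.
  by rewrite /data_deriv2 mulrCA mulrA.
Qed.

Lemma source_potentialB f0 f1 h0 h1 y :
  measurable_fun setT f0 -> measurable_fun setT f1 ->
  measurable_fun setT h0 -> measurable_fun setT h1 ->
  leb.-integrable om (EFin \o f0) -> leb.-integrable om (EFin \o f1) ->
  leb.-integrable om (EFin \o h0) -> leb.-integrable om (EFin \o h1) -> om y ->
  source_potential sigma tau b (f0 \- h0) (f1 \- h1) y
  = source_potential sigma tau b f0 f1 y - source_potential sigma tau b h0 h1 y.
Proof.
have si g0 g1 : measurable_fun setT g0 -> measurable_fun setT g1 ->
    leb.-integrable om (EFin \o g0) -> leb.-integrable om (EFin \o g1) -> om y ->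
    leb.-integrable om (EFin \o (fun z => source sigma tau g0 g1 z `|y - z|)).
  move=> mg0 mg1 ig0 ig1 yo; have [B [iB wB _ _]] := source_bound s0 tau0 b0 ig0 ig1.
  apply: (le_integrable_real mo _ _ iB); last by move=> z zo; exact: wB.
  apply: measurable_funTS.
  have my : measurable_fun setT (fun z : R => (y, z)) by exact: measurable_fun_pair.
  exact: (measurableT_comp (measurable_source s0 tau0 mg0 mg1) my).
move=> mf0 mf1 mh0 mh1 if0 if1 ih0 ih1 yo.
rewrite /source_potential -RintegralB//; [|exact: si|exact: si].
by apply: eq_Rintegral => z _ /=; ring.
Qed.

(** Two solutions with the same data at the time [tau] differ by a source whose
    potential vanishes on [omega], and so does its second derivative. *)
Lemma data_deriv2_eq0 V f0 f1 h0 h1 : Linfty0 b f0 -> Linfty0 b f1 ->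
  Linfty0 b h0 -> Linfty0 b h1 ->
  (forall y, om y -> cauchy_solution s sigma mu r f0 f1 y tau = V y) ->
  (forall y, om y -> cauchy_solution s sigma mu r h0 h1 y tau = V y) ->
  normoo b (data_deriv2 s sigma b tau (f0 \- h0) (f1 \- h1)) = 0%E.
Proof.
move=> L0 L1 M0 M1 fV hV.
have [mf0 [X0 fX0]] := Linfty0_bounded b0 L0.
have [mf1 [X1 fX1]] := Linfty0_bounded b0 L1.
have [mh0 [Y0 hY0]] := Linfty0_bounded b0 M0.
have [mh1 [Y1 hY1]] := Linfty0_bounded b0 M1.
have if0 := ae_bounded_integrable b0 mf0 fX0; have if1 := ae_bounded_integrable b0 mf1 fX1.
have ih0 := ae_bounded_integrable b0 mh0 hY0; have ih1 := ae_bounded_integrable b0 mh1 hY1.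
have W0 y : om y -> source_potential sigma tau b (f0 \- h0) (f1 \- h1) y = 0.
  move=> yo; rewrite source_potentialB//; apply/eqP; rewrite subr_eq0; apply/eqP.
  apply: (@mulfI _ s); first by rewrite gt_eqF.
  by rewrite -(untiltedE L0 L1 fV yo) -(untiltedE M0 M1 hV yo).
have md0 : measurable_fun setT (f0 \- h0) by exact: measurable_funB.
have md1 : measurable_fun setT (f1 \- h1) by exact: measurable_funB.
have id0 : leb.-integrable om (EFin \o (f0 \- h0)).
  have := @integrableB _ _ _ leb _ mo _ _ if0 ih0; exact: eq_integrable.
have id1 : leb.-integrable om (EFin \o (f1 \- h1)).
  have := @integrableB _ _ _ leb _ mo _ _ if1 ih1; exact: eq_integrable.
have [_ ig] := source_potential_integrable s0 tau0 b0 md0 md1 id0 id1.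
apply/eqP; rewrite eq_le normoo_ge0// andbT; apply/normooP.
have := @ae_null_of_pairings R b _ ig; set g := source_potential2 _ _ _ _ _ => h.
suff : {ae leb, forall x, om x -> g x = 0}.
  by apply: filterS => y gy yo; rewrite /data_deriv2 -/g gy// mulr0 normr0.
apply: h => x rr bx r0 xb.
have xr : x - rr < x + rr by rewrite ltrD2l gtrN.
have bp q : (q - x) ^+ 2 = rr ^+ 2 -> quartic_bump x rr q = 0 /\ quartic_bump1 x rr q = 0.
  by move=> qx; rewrite /quartic_bump /quartic_bump1 qx subrr mulr0 mul0r expr0n.
have [q1 q1'] : quartic_bump x rr (x - rr) = 0 /\ quartic_bump1 x rr (x - rr) = 0 by apply: bp; ring.
have [q2 q2'] : quartic_bump x rr (x + rr) = 0 /\ quartic_bump1 x rr (x + rr) = 0 by apply: bp; ring.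
rewrite /g -(source_potential_weak_derivative s0 tau0 b0 md0 md1 id0 id1
  (quartic_bump_deriv x rr) (quartic_bump1_deriv x rr) (@quartic_bump2_continuous _ x rr) bx xr xb q1 q2 q1' q2').
transitivity (\int[leb]_(y in `]x - rr, x + rr[) (0 : R)); last first.
  by rewrite Rintegral_cst// mul0r.
apply: eq_Rintegral => y; rewrite inE/= in_itv/= => /andP[y1 y2].
rewrite W0 ?mul0r// /omega/= in_itv/=.
by rewrite (le_lt_trans bx y1) (lt_le_trans y2 xb).
Qed.

End inverse_problem.

Theorem theorem4p1 (R : realType) (s sigma tau1 tau2 b : R) :
  0 < s -> 0 < sigma -> 0 < tau1 -> tau1 < tau2 -> 0 < b ->
  (tau1 ^+ 2 + tau2 ^+ 2 + Num.sqrt (tau1 * tau2) * (tau1 + tau2))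
    / (tau1 * tau2 * (tau2 - tau1)) * (3 * b ^+ 2 / (2 * sigma ^+ 2)) < 1 ->
  ((Num.sqrt (tau1 / tau2) + Num.sqrt (tau2 / tau1) + 2) * (b ^+ 2 / sigma ^+ 2)
     + 2 * Num.sqrt (2 * pi) * (Num.sqrt tau1 + Num.sqrt tau2) * (b / sigma))
    / (2 * (tau2 - tau1)) < 1 ->
  (forall (mu r : R) (V1 V2 f0 f1 h0 h1 : R -> R),
     inverse_solution s sigma mu r tau1 tau2 b V1 V2 f0 f1 ->
     inverse_solution s sigma mu r tau1 tau2 b V1 V2 h0 h1 ->
     f0 = h0 %[ae lebesgue_measure in omega b] /\
     f1 = h1 %[ae lebesgue_measure in omega b]) /\
  (exists C : R, forall (mu r : R) (V1 V2 f0 f1 : R -> R),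
     inverse_solution s sigma mu r tau1 tau2 b V1 V2 f0 f1 ->
     exists g1 g2 : R -> R,
       [/\ is_weak_derivative2 b
             (fun y => expR (- coef_c sigma mu * y - coef_d sigma mu r * tau1)
                       * V1 y) g1,
           is_weak_derivative2 b
             (fun y => expR (- coef_c sigma mu * y - coef_d sigma mu r * tau2)
                       * V2 y) g2 &
           (normoo b f0 + normoo b f1 <= C%:E * (normoo b g1 + normoo b g2))%E]).
Proof.
move=> s_gt0 s0 tau10 tau12 b0 small0 small1.
have tau20 := lt_trans tau10 tau12.
have [C CP] := stability s_gt0 s0 tau10 tau12 b0 small0 small1.
split.
  move=> mu r V1 V2 f0 f1 h0 h1 [L0 L1 fV1 fV2] [M0 M1 hV1 hV2].
  have [mf0 [X0 fX0]] := Linfty0_bounded b0 L0.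
  have [mf1 [X1 fX1]] := Linfty0_bounded b0 L1.
  have [mh0 [Y0 hY0]] := Linfty0_bounded b0 M0.
  have [mh1 [Y1 hY1]] := Linfty0_bounded b0 M1.
  have bB f h X Y : ae_bounded b f X -> ae_bounded b h Y -> ae_bounded b (f \- h) (X + Y).
    apply: filterS2 => x fx hx xo; rewrite /= (le_trans (ler_normB _ _))// lerD//.
      exact: fx.
    exact: hx.
  have := CP (f0 \- h0) (f1 \- h1) _ _ (measurable_funB mf0 mh0) (measurable_funB mf1 mh1)
    (bB _ _ _ _ fX0 hY0) (bB _ _ _ _ fX1 hY1).
  rewrite (data_deriv2_eq0 s_gt0 s0 tau10 b0 L0 L1 M0 M1 fV1 hV1).
  rewrite (data_deriv2_eq0 s_gt0 s0 tau20 b0 L0 L1 M0 M1 fV2 hV2) adde0 mule0 => le0.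
  have n0 (f h : R -> R) : (normoo b (f \- h)%R <= 0)%E -> f = h %[ae lebesgue_measure in omega b].
    move=> /normooP; apply: filterS => x fh xo; apply/eqP.
    by rewrite -subr_eq0 -normr_le0; exact: fh.
  split; apply: n0; apply: le_trans le0.
    by rewrite leeDl// normoo_ge0.
  by rewrite leeDr// normoo_ge0.
exists C => mu r V1 V2 f0 f1 [L0 L1 fV1 fV2].
exists (data_deriv2 s sigma b tau1 f0 f1), (data_deriv2 s sigma b tau2 f0 f1).
split.
- exact: (untilted_weak_derivative2 s_gt0 s0 tau10 b0 L0 L1 fV1).
- exact: (untilted_weak_derivative2 s_gt0 s0 tau20 b0 L0 L1 fV2).
have [mf0 [X0 fX0]] := Linfty0_bounded b0 L0.
have [mf1 [X1 fX1]] := Linfty0_bounded b0 L1.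
exact: CP mf0 mf1 fX0 fX1.
Qed.
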